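(* Let $M$ be a $C^0$-submanifold of a manifold $P$ and let $x \in M$. (1) Let $F$ be a $(\mathrm{codim}_x M)$-dimensional vector subspace of $T_xP$. The $C^0$-submanifold $M$ is locally at $x$ the graph of a Lipschitz map with codomain tangent to $F$ if and only if $C_x(M,M) \cap F = \{0\}$. (2) The $C^0$-submanifold $M$ is locally at $x$ the graph of a map $f$ strictly differentiable at $x$ if and only if $C_x(M,M)$ is contained in a $(\dim_x M)$-dimensional vector subspace of $T_xP$, and in that case, $C_x(M,M) = \Gamma_{T_xf}$.
   Context: Manifolds are real, finite-dimensional, smooth ($C^\infty$), paracompact and Hausdorff. A $C^0$-submanifold is a topological submanifold that is locally flatly embedded (its inclusion is locally homeomorphic to a linear inclusion $\mathbb{R}^m \hookrightarrow \mathbb{R}^p$), hence locally closed. Whitney cone: for subsets $A,B$ of $P$ and $p\in P$, $C_p(A,B)$ is the set of $u \in T_pP$ for which there are sequences $x_n \in A$, $y_n \in B$, $c_n \in \mathbb{R}_{>0}$ with $x_n \to p$, $y_n \to p$ and $c_n(y_n - x_n) \to u$ (computed in a chart at $p$; independent of the chart). ''$M$ is locally at $x$ the graph of a map'' means: there exist an open neighborhood $U$ of $x$ in $P$, a chart $\phi = (\phi_M,\phi_N) \colon U \to U_M \times U_N \subseteq \mathbb{R}^m \times \mathbb{R}^n$ (a diffeomorphism onto $U_M\times U_N$, $m=\dim_xM$, $n=\mathrm{codim}_xM$) and a map $f \colon U_M \to U_N$ with $\phi(M \cap U) = \Gamma_f$ (the graph of $f$). ''$f$ strictly differentiable at $x$''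 means strictly differentiable at $\phi_M(x)$, $T_xf$ means $T_{\phi_M(x)}f$, and $C_x(M,M)$ is identified with its image under $T_x\phi$. ''The codomain of $f$ is tangent to $F$'' means $T_x\phi(F) = \{0\} \times \mathbb{R}^n$. Lipschitz: a continuous map between manifolds is Lipschitz at a point if, in some charts, it is $C$-Lipschitz on some neighborhood of that point for some $C$; it is Lipschitz if it is so at each point. Strictly differentiable at $y$: there is a linear map $L$ (then equal to $T_yf$) such that, in charts, for every $\epsilon>0$ the map $f-L$ is $\epsilon$-Lipschitz on some neighborhood of $y$. *)

(* Defs.v *)
From HB Require Import structures.
From mathcomp Require Import all_boot all_order all_algebra.
From mathcomp Require Import all_classical all_reals topology normedtype derive.

Set Implicit Arguments.
Unset Strict Implicit.
Unset Printing Implicit Defensive.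
Import Order.TTheory GRing.Theory Num.Theory.
Import numFieldNormedType.Exports.
Local Open Scope classical_set_scope.
Local Open Scope ring_scope.

(* C^k on the open set U, for a function that is total but only relevant on U:
   C^(k+1) means differentiable on U with all x |-> df_x(v) of class C^k; in
   finite dimension this is equivalent to x |-> df_x being of class C^k. *)
Fixpoint class_C (R : realType) (d e k : nat) (U : set 'rV[R]_d)
    (f : 'rV[R]_d -> 'rV[R]_e) {struct k} : Prop :=
  match k with
  | 0 => forall x, U x -> {for x, continuous f}
  | k'.+1 => (forall x, U x -> differentiable f x) /\
      forall v : 'rV[R]_d, class_C k' U (fun x => 'd f x v)
  end.

Definition smooth_on (R : realType) (d e : nat) (U : set 'rV[R]_d)
    (f : 'rV[R]_d -> 'rV[R]_e) : Prop :=
  forall k, class_C k U f.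

(* Homeomorphism from an open subset of T onto an open subset of R^d. Both maps
   are total; their values outside chart_dom and its image are irrelevant. *)
Record chart (R : realType) (T : topologicalType) (d : nat) := Chart {
  chart_dom : set T;
  chart_map :> T -> 'rV[R]_d;
  chart_inv : 'rV[R]_d -> T;
  chart_dom_open : open chart_dom;
  chart_img_open : open (chart_map @` chart_dom);
  chart_mapK : forall x, chart_dom x -> chart_inv (chart_map x) = x;
  chart_map_continuous : forall x, chart_dom x -> {for x, continuous chart_map};
  chart_inv_continuous :
    forall v, (chart_map @` chart_dom) v -> {for v, continuous chart_inv}
}.

Definition transition (R : realType) (T : topologicalType) (d e : nat)
    (c : chart R T d) (c' : chart R T e) : 'rV[R]_d -> 'rV[R]_e :=
  c' \o chart_inv c.

Definition compatible (R : realType) (T : topologicalType) (d e : nat)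
    (c : chart R T d) (c' : chart R T e) : Prop :=
  smooth_on (c @` (chart_dom c `&` chart_dom c')) (transition c c') /\
  smooth_on (c' @` (chart_dom c `&` chart_dom c')) (transition c' c).

Definition paracompact_space (T : topologicalType) : Prop :=
  forall U : set (set T), U `<=` open -> \bigcup_(A in U) A = setT ->
  exists V : set (set T), [/\ V `<=` open, \bigcup_(B in V) B = setT,
    forall B, V B -> exists2 A, U A & B `<=` A &
    forall x : T, exists2 W, nbhs x W & finite_set [set B | V B /\ B `&` W !=set0]].

(* The dimension may vary from one connected component to another. Each point
   comes with a preferred chart of the atlas around it. *)
Record manifold (R : realType) := Manifold {
  carrier :> topologicalType;
  manifold_hausdorff : hausdorff_space carrier;
  manifold_paracompact : paracompact_space carrier;
  atlas : forall d, set (chart R carrier d);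
  atlas_compatible : forall d e (c : chart R carrier d) (c' : chart R carrier e),
    atlas c -> atlas c' -> compatible c c';
  dim_at : carrier -> nat;
  chart_at : forall x, chart R carrier (dim_at x);
  chart_at_atlas : forall x, atlas (chart_at x);
  chart_at_dom : forall x, chart_dom (chart_at x) x
}.

(* Charts of the maximal atlas, that is, diffeomorphisms from an open subset of
   P onto an open subset of R^d. *)
Definition smooth_chart (R : realType) (P : manifold R) (d : nat)
    (c : chart R P d) : Prop :=
  forall e (c' : chart R P e), atlas c' -> compatible c c'.

(* The tangent space T_xP is 'rV[R]_(dim_at x): a tangent vector is represented
   by its coordinates in the preferred chart at x, and its expression in any other
   chart around x is given by tangent_map. *)
Definition tangent_map (R : realType) (P : manifold R) (x : P) (d : nat)
    (c : chart R P d) : 'rV[R]_(dim_at x) -> 'rV[R]_d :=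
  'd (transition (chart_at x) c) (chart_at x x).

Arguments tangent_map {R P} x {d} c _.

Definition whitney_cone (R : realType) (P : manifold R) (p : P) (A B : set P) :
    set 'rV[R]_(dim_at p) :=
  [set u | exists (x y : nat -> P) (c : nat -> R),
    [/\ forall n, [/\ A (x n), B (y n) & 0 < c n],
        x n @[n --> \oo] --> p, y n @[n --> \oo] --> p &
        c n *: (chart_at p (y n) - chart_at p (x n)) @[n --> \oo] --> u]].

Arguments whitney_cone {R P} p A B _.

Definition locally_flat_at (R : realType) (P : manifold R) (M : set P) (x : P)
    (m : nat) : Prop :=
  exists n : nat, (m + n)%N = dim_at x /\ exists c : chart R P (m + n),
    chart_dom c x /\
    c @` (M `&` chart_dom c) = c @` chart_dom c `&` [set v | rsubmx v = 0].

Definition C0_submanifold (R : realType) (P : manifold R) (M : set P) : Prop :=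
  forall x, M x -> exists m, locally_flat_at M x m.

(* By invariance of domain at most one m satisfies locally_flat_at M x m. *)
Definition submanifold_dim (R : realType) (P : manifold R) (M : set P) (x : P) :
    nat :=
  xget 0%N [set m | locally_flat_at M x m].

Definition submanifold_codim (R : realType) (P : manifold R) (M : set P)
    (x : P) : nat :=
  (dim_at x - submanifold_dim M x)%N.

(* Pointwise Lipschitz condition and strict differentiability for maps between
   open subsets of R^m and R^n, in the standard coordinates (both properties are
   invariant under smooth changes of coordinates). *)
Definition lipschitz_at (R : realType) (m n : nat)
    (f : 'rV[R]_m -> 'rV[R]_n) (y : 'rV[R]_m) : Prop :=
  exists C : R, exists2 V : set 'rV[R]_m, nbhs y V & C.-lipschitz_V f.

Definition strictly_differentiable (R : realType) (m n : nat)
    (f : 'rV[R]_m -> 'rV[R]_n) (y : 'rV[R]_m) : Prop :=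
  exists L : {linear 'rV[R]_m -> 'rV[R]_n}, forall e : R, 0 < e ->
    exists2 V : set 'rV[R]_m, nbhs y V & e.-lipschitz_V (f \- L).

(* In the chart phi = (phi_M, phi_N) from the open neighborhood chart_dom phi
   of x onto UM x UN, the set M is the graph of f : UM -> UN. *)
Record local_graph (R : realType) (P : manifold R) (M : set P) (x : P)
    (m n : nat) (phi : chart R P (m + n)) (UM : set 'rV[R]_m)
    (UN : set 'rV[R]_n) (f : 'rV[R]_m -> 'rV[R]_n) : Prop := LocalGraph {
  local_graph_smooth : smooth_chart phi;
  local_graph_dom : chart_dom phi x;
  local_graph_openM : open UM;
  local_graph_openN : open UN;
  local_graph_img :
    phi @` chart_dom phi = [set row_mx a b | a in UM & b in UN];
  local_graph_maps : forall a, UM a -> UN (f a);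
  local_graph_eq :
    phi @` (M `&` chart_dom phi) = [set row_mx a (f a) | a in UM]
}.

(* Main.v *)
Require Import Defs.
From HB Require Import structures.
From mathcomp Require Import all_boot all_order all_algebra.
From mathcomp Require Import all_classical all_reals topology normedtype landau derive.
From mathcomp Require Import ring lra.

Set Implicit Arguments.
Unset Strict Implicit.
Unset Printing Implicit Defensive.
Import Order.TTheory GRing.Theory Num.Theory.
Import numFieldNormedType.Exports.
Local Open Scope classical_set_scope.
Local Open Scope ring_scope.

(** A linear frame adapted to F and to a complement of F turns the chart at x
    into a chart with values in R^m x R^n in which F is the vertical factor.  The
    Whitney cone is the set of limits of rescaled secants of M at x.  If it meets
    F only in 0, then, the unit sphere being compact, the slopes of the secants
    of M near x are bounded ([secant_cone_lipschitz]), so that M is near x the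
    graph of a Lipschitz map over its projection to R^m.  That projection is a
    neighbourhood of the projection of x by invariance of domain, applied to the
    projection of a flat parametrization of M ([projection_open]); this gives the
    graph ([lipschitz_local_graph]).  If the cone is moreover contained in the
    horizontal factor, the slopes tend to 0 at x ([secant_cone_flat]), which says
    that the map is strictly differentiable at x with derivative 0
    ([local_graph_of_cone]).

    Conversely, a map of class C^1 is strictly differentiable
    ([C1_strictly_differentiable]) and therefore carries rescaled secants to
    rescaled secants up to its differential.  Hence the Whitney cone read in any
    smooth chart is the cone of secants of the image of M ([tangent_map_cone]).
    For a graph this cone is easy to compute: it has no nonzero vertical vector when
    the map is Lipschitz ([lipschitz_graph_cone]), and it is the graph of the
    derivative when the map is strictly differentiable ([strict_graph_cone],
    [graph_cone_strict]).

    Invariance of domain is derived from the Poincare-Miranda theorem by an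
    argument due to Kulpa and Tao.  Let h be continuous and injective on the unit
    cube, and let c be a point near h 0 that is not a value of h.  An
    inf-convolution gives a Lipschitz map P on R^m with P (h x) close to x.  Push
    the points at distance less than e from c radially to the sphere of radius e
    around c; this is continuous on the image of h, which avoids c.  A Lipschitz
    map cannot map a sphere onto a set containing a ball
    ([lipschitz_sphere_misses]), so a small shift makes P nonzero on the sphere.
    The composite of h, the push and the shifted P then has no zero on the cube,
    although it satisfies the sign conditions of the Poincare-Miranda theorem.

    The Poincare-Miranda theorem itself comes from a parity argument on a cubical
    grid.  Label every vertex with the signs of the m components; the coboundaries
    of the m labels are 1-cocycles modulo 2, and the sum over all cells of their
    cup product depends only on the values of the labels on the boundary of the
    grid, and these force it to be 1 ([walk_total]).  So in some cell every
    component changes sign. *)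

(** * Cup products of labels on a cubical grid *)

(** Coordinates live in a cyclic ring, where [-1] is the last of the [N.+2]
    values: translations are then bijections of the whole grid, and the cells are
    based at the vertices without coordinate [-1]. *)
Definition grid (m N : nat) := {ffun 'I_m -> 'I_N.+2}.

Definition grid_step (m N : nat) (j : 'I_m) : grid m N := [ffun i => (i == j)%:R].

Lemma grid_stepE m N (j i : 'I_m) : grid_step N j i = (i == j)%:R.
Proof. by rewrite ffunE. Qed.

Lemma addF2_self (x : 'F_2) : x + x = 0.
Proof. by apply/val_inj; case: x => [[|[|]]]. Qed.

Lemma addF2_eq0 (x y : 'F_2) : x + y = 0 -> x = y.
Proof. by move=> h; rewrite -[x]addr0 -(addF2_self y) addrA h add0r. Qed.

(** The cup product of the coboundaries of the labels [l i], for [i] in [s],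
    on the cell based at [v] with directions [S]: a sum over the monotone edge
    paths from [v] to the opposite vertex.  Modulo 2 the
    orientation signs disappear. *)
Fixpoint walk (m N : nat) (l : 'I_m -> grid m N -> 'F_2) (s : seq 'I_m)
    (S : {set 'I_m}) (v : grid m N) : 'F_2 :=
  if s is i :: s' then
    \sum_(j in S) (l i (v + grid_step N j) + l i v) *
                  walk l s' (S :\ j) (v + grid_step N j)
  else 1.

Lemma sum_sym_pairs (I : finType) (S : {set I}) (F : I -> I -> 'F_2) :
  (forall i j, F i j = F j i) ->
  \sum_(i in S) \sum_(j in S :\ i) F i j = 0.
Proof.
move: {2}#|S| (erefl #|S|) => n; elim: n S => [|n IH] S cS FC.
  by rewrite (cards0_eq cS) big_set0.
have [a aS] : exists a, a \in S by apply/set0Pn; rewrite -card_gt0 cS.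
have cSa : #|S :\ a| = n by move: cS; rewrite (cardsD1 a) aS => -[].
rewrite (big_setD1 a aS) /=.
rewrite [X in _ + X](_ : _ = \sum_(i in S :\ a) F a i +
    \sum_(i in S :\ a) \sum_(j in S :\ a :\ i) F i j).
  by rewrite IH// addr0 addF2_self.
rewrite -big_split; apply: eq_bigr => i iSa; rewrite (big_setD1 a) /=; last first.
  by move: iSa; rewrite !inE aS andbT eq_sym => /andP[].
by rewrite FC; congr (_ + _); apply: eq_bigl => j; rewrite !inE andbCA.
Qed.

(** A cup product of cocycles is a cocycle: the sums over the front faces and
    over the back faces of a cell agree.  Expanding the first edge of each path
    leaves terms that are symmetric in the first two directions, and these cancel
    in pairs. *)
Lemma walk_closed m N (l : 'I_m -> grid m N -> 'F_2) s (S : {set 'I_m}) v :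
  #|S| = (size s).+1 ->
  \sum_(j in S) walk l s (S :\ j) (v + grid_step N j) =
  \sum_(j in S) walk l s (S :\ j) v.
Proof.
elim: s S v => [|i s IH] S v cS //=.
have cSj j : j \in S -> #|S :\ j| = (size s).+1.
  by move=> jS; move: cS; rewrite (cardsD1 j) jS => -[].
pose w j k := walk l s (S :\ j :\ k) (v + grid_step N j + grid_step N k).
have wC j k : w j k = w k j.
  by rewrite /w addrAC; congr walk; apply/setP => a; rewrite !inE andbCA.
transitivity (\sum_(j in S) \sum_(k in S :\ j) l i (v + grid_step N j) * w j k).
  apply/addF2_eq0; rewrite -big_split /= -[RHS](@sum_sym_pairs _ S
    (fun j k => l i (v + grid_step N j + grid_step N k) * w j k)); last first.
    by move=> j k; rewrite wC addrAC.
  apply: eq_bigr => j jS; rewrite -big_split /=; apply: eq_bigr => k _.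
  by rewrite -/(w j k) mulrDl -addrA addF2_self addr0.
transitivity (\sum_(j in S) \sum_(k in S :\ j)
    l i (v + grid_step N j) * walk l s (S :\ j :\ k) (v + grid_step N j)).
  by apply: eq_bigr => j jS; rewrite -!mulr_sumr IH // cSj.
pose u j k := walk l s (S :\ j :\ k) (v + grid_step N k).
transitivity (\sum_(j in S) \sum_(k in S :\ j) l i (v + grid_step N k) * u j k).
  rewrite (exchange_big_dep (mem S)) /=; last by move=> j k _; rewrite !inE => /andP[].
  apply: eq_bigr => j jS; rewrite (eq_bigl (fun k => k \in S :\ j)); last first.
    by move=> k; rewrite !inE jS andbT andbC eq_sym.
  apply: eq_bigr => k _; rewrite /u; congr (_ * walk _ _ _ _).
  by apply/setP => a; rewrite !inE andbCA.
apply/addF2_eq0; rewrite -big_split /=.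
transitivity (\sum_(j in S) \sum_(k in S :\ j) l i v * u j k).
  apply: eq_bigr => j jS; rewrite -big_split /=; apply: eq_bigr => k _.
  by rewrite -/(u j k) mulrDl addrA addF2_self add0r.
transitivity (\sum_(j in S) \sum_(k in S :\ j) l i v * walk l s (S :\ j :\ k) v).
  by apply: eq_bigr => j jS; rewrite -!mulr_sumr IH // cSj.
apply: sum_sym_pairs => j k; congr (_ * walk _ _ _ _).
by apply/setP => a; rewrite !inE andbCA.
Qed.

(** A path inside a face on which the label [l j] is constant contains no edge
    along which [l j] changes. *)
Lemma walk_face m N (l : 'I_m -> grid m N -> 'F_2) s (S : {set 'I_m})
    (v : grid m N) (j : 'I_m) (c : 'I_N.+2) :
  (forall u u' : grid m N, u j = c -> u' j = c -> l j u = l j u') ->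
  j \in s -> j \notin S -> v j = c -> walk l s S v = 0.
Proof.
move=> lc; elim: s S v => // i s IH S v; rewrite in_cons => /predU1P ji jS vj /=.
apply: big1 => k kS; have kj : j == k = false by apply: contraNF jS => /eqP->.
have vkj : (v + grid_step N k) j = c by rewrite ffunE grid_stepE kj addr0.
case: ji => [<-|js]; first by rewrite (lc _ v vkj vj) addF2_self mul0r.
by rewrite IH ?mulr0// !inE kj.
Qed.

(** Summing the increments in direction [j] telescopes to the two opposite
    faces. *)
Lemma sum_shift m N (j : 'I_m) (D : pred (grid m N)) (h : grid m N -> 'F_2) :
  (forall v, D (v + grid_step N j) = D v) ->
  \sum_(v | D v && (v j != -1)) (h (v + grid_step N j) + h v) =
  \sum_(v | D v && (v j == -1)) h v + \sum_(v | D v && (v j == 0)) h v.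
Proof.
move=> Dj; rewrite big_split /=.
transitivity (\sum_(v | D v && (v j != 0)) h v + \sum_(v | D v && (v j != -1)) h v).
  congr (_ + _); rewrite [RHS](reindex_inj (addIr (grid_step N j))) /=.
  by apply: eq_bigl => v; rewrite Dj !ffunE eqxx -subr_eq0 opprK.
pose tot := \sum_(v | D v) h v.
have e c : \sum_(v | D v && (v j != c)) h v = tot + \sum_(v | D v && (v j == c)) h v.
  by rewrite /tot [\sum_(v | D v) _](bigID (fun v : grid m N => v j == c)) /= addrAC addF2_self add0r.
by rewrite !e addrACA addF2_self add0r addrC.
Qed.

(** Discrete Stokes theorem: integrating the coboundary of the first label moves
    the sum to the faces of the grid.  On the faces transverse to another
    direction [j] the label [l j] is constant, so these contribute nothing; on the
    two faces transverse to [i] the label [l i] is 0 and 1.  What is left is the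
    same sum for the remaining labels on a face of one dimension less. *)
Lemma walk_total m N (l : 'I_m -> grid m N -> 'F_2) s :
  (forall i (v : grid m N), v i = 0 -> l i v = 0) -> (forall i (v : grid m N), v i = -1 -> l i v = 1) ->
  uniq s ->
  \sum_(v : grid m N | [forall i, (v i == -1) == (i \notin s)])
     walk l s [set i in s] v = 1.
Proof.
move=> l0 l1; elim: s => [_|i s IH /= /andP[nis us]].
  rewrite (big_pred1 [ffun=> -1]) // => v; apply/forallP/eqP => [h|->].
    by apply/ffunP => i; rewrite ffunE; apply/eqP; move: (h i); rewrite eqb_id.
  by move=> i; rewrite ffunE eqxx.
rewrite -{}[RHS]IH //; pose S : {set 'I_m} := [set j in i :: s]; 
pose D (v : grid m N) := [forall j, (v j == -1) == (j \notin i :: s)].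
rewrite -/S.
pose h j v := l i v * walk l s (S :\ j) v.
have cS : #|S| = (size s).+1 by rewrite cardsE; apply/(@card_uniqP _ (i :: s)); rewrite /= nis.
transitivity (\sum_(j in S) \sum_(v | D v) (h j (v + grid_step N j) + h j v)).
  rewrite [RHS]exchange_big /=; apply: eq_bigr => v Dv.
  rewrite [RHS]big_split /= [X in _ = _ + X](_ : _ = l i v * \sum_(j in S) walk l s (S :\ j) v).
    2: by rewrite mulr_sumr.
  rewrite -walk_closed // mulr_sumr -big_split.
  by apply: eq_bigr => j jS; rewrite /h mulrDl.
pose D' j (v : grid m N) := [forall (k | k != j), (v k == -1) == (k \notin i :: s)].
have DE j v : j \in S -> D v = D' j v && (v j != -1).
  rewrite inE => jS; apply/forallP/andP => [h'|[/forallP h' vj] k].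
    split; first by apply/forallP => k; apply/implyP.
    by have := h' j; rewrite jS; case: (v j == -1).
  by have [->|kj] := eqVneq k j; [rewrite jS (negbTE vj)|have := h' k; rewrite kj].
have D'j j v : D' j (v + grid_step N j) = D' j v.
  by apply: eq_forallb => k; case: eqVneq => //= kj; rewrite !ffunE (negbTE kj) addr0.
have hj j c (v : grid m N) : j \in S -> j != i -> (c == 0) || (c == -1) -> v j = c -> h j v = 0.
  move=> jS ji cc vj; rewrite /h (@walk_face _ _ _ _ _ _ j c) ?mulr0//.
  - by case/orP: cc => /eqP-> u u' e e'; [rewrite !l0|rewrite !l1].
  - by move: jS; rewrite inE in_cons (negbTE ji).
  - by rewrite !inE eqxx.
have iS : i \in S by rewrite inE in_cons eqxx.
have step1 j : j \in S -> \sum_(v | D v) (h j (v + grid_step N j) + h j v) =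
   \sum_(v | D' j v && (v j == -1)) h j v + \sum_(v | D' j v && (v j == 0)) h j v.
  by move=> jS; rewrite -sum_shift //; apply: eq_bigl => v; exact: DE.
(* only the direction [i] contributes to the boundary *)
rewrite (bigD1 i iS) /= [X in _ + X]big1 ?addr0; last first.
  move=> j /andP[jS ji]; rewrite step1 //.
  by rewrite !big1 ?addr0// => v /andP[_ /eqP]; apply: hj; rewrite // eqxx ?orbT.
rewrite step1 // [X in _ + X]big1 ?addr0; last first.
  by move=> v /andP[_ /eqP vi]; rewrite /h l0 // mul0r.
have SE : S :\ i = [set j in s].
  by apply/setP => j; rewrite !inE; case: eqVneq => // ->; rewrite (negbTE nis).
apply: eq_big => [v|v /andP[_ /eqP vi]]; last by rewrite /h l1 // mul1r SE.
apply/andP/forallP => [[/forallP h' vi] k|h'].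
  have [->|ki] := eqVneq k i; first by rewrite vi nis.
  by have := h' k; rewrite ki in_cons (negbTE ki).
split; last by have := h' i; rewrite nis eqb_id.
by apply/forallP => k; apply/implyP => ki; rewrite in_cons (negbTE ki); exact: h'.
Qed.

Definition in_cell m N (v u : grid m N) :=
  forall j, u j = v j \/ u j = v j + 1.

Lemma walk_neq0 m N (l : 'I_m -> grid m N -> 'F_2) s (S : {set 'I_m}) v :
  walk l s S v != 0 -> forall i, i \in s ->
  exists u u' : grid m N, [/\ forall j, u j = v j \/ j \in S /\ u j = v j + 1,
                   forall j, u' j = v j \/ j \in S /\ u' j = v j + 1 & l i u != l i u'].
Proof.
elim: s S v => // i s IH S v /= h.
have [j /andP[jS]] : exists j, (j \in S) &&
    ((l i (v + grid_step N j) + l i v) * walk l s (S :\ j) (v + grid_step N j) != 0).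
  apply/existsP; apply: contraR h; rewrite negb_exists => /forallP h.
  by apply/eqP; apply: big1 => j jS; have := h j; rewrite jS negbK => /eqP.
rewrite mulf_eq0 negb_or => /andP[hi hw] k; rewrite in_cons => /predU1P[->{k}|ks].
  exists (v + grid_step N j), v; split.
  - move=> k; rewrite ffunE grid_stepE; have [->|kj] := eqVneq k j; [by right|left].
    by rewrite addr0.
  - by left.
  - by apply: contra hi => /eqP->; rewrite addF2_self.
have [u [u' [hu hu' luu']]] := IH _ _ hw _ ks.
have shrink (w : grid m N) :
    (forall q, w q = (v + grid_step N j) q \/ q \in S :\ j /\ w q = (v + grid_step N j) q + 1) ->
    forall q, w q = v q \/ q \in S /\ w q = v q + 1.
  move=> hw' q; have := hw' q; rewrite !inE !ffunE.
  have [->|_] := eqVneq q j; first by case=> [->|[]] //; right.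
  by rewrite addr0.
by exists u, u'; split=> //; apply: shrink.
Qed.

(** Sperner-type lemma for cubes: labels with the boundary values of the
    coordinate functions all change within a single cell. *)
Lemma grid_cell m N (l : 'I_m -> grid m N -> bool) :
  (forall i (v : grid m N), v i = 0 -> l i v = false) -> (forall i (v : grid m N), v i = -1 -> l i v = true) ->
  exists2 v : grid m N, forall i, v i != -1 &
    forall i, exists u u' : grid m N, [/\ in_cell v u, in_cell v u', l i u & ~~ l i u'].
Proof.
move=> l0 l1; pose lF i v : 'F_2 := (l i v)%:R.
have T1 : \sum_(v : grid m N | [forall i, (v i == -1) == (i \notin enum 'I_m)])
     walk lF (enum 'I_m) [set i in enum 'I_m] v = 1.
  by apply: walk_total; rewrite ?enum_uniq // /lF => i v /[dup] h; [move/l0->|move/l1->].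
have [v /andP[/forallP hv hw]] : exists v, [forall i, ((v : grid m N) i == -1) == (i \notin enum 'I_m)] &&
    (walk lF (enum 'I_m) [set i in enum 'I_m] v != 0).
  apply/existsP; apply: contraT; rewrite negb_exists => /forallP h.
  suff : (0 : 'F_2) = 1 by move/eqP; rewrite eq_sym oner_eq0.
  rewrite -T1; apply/esym/big1 => v hv; have := h v; rewrite hv negbK; exact/eqP.
exists v => [i|i]; first by have := hv i; rewrite mem_enum; case: (v i == -1).
have [|u [u' [hu hu' e]]] := walk_neq0 hw (i := i); first by rewrite mem_enum.
have cu : in_cell v u by move=> j; case: (hu j) => [|[_]]; [left|right].
have cu' : in_cell v u' by move=> j; case: (hu' j) => [|[_]]; [left|right].
move: e; rewrite /lF; case lu: (l i u); case lu': (l i u'); rewrite ?eqxx // => _.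
- by exists u, u'; rewrite lu lu'.
- by exists u', u; rewrite lu lu'.
Qed.

(** * Norms and limits in spaces of row vectors *)

Section epsilon_delta.
Context {R : realType} {V W : normedModType R}.

Lemma continuous_eps_delta (f : V -> W) (x : V) :
  {for x, continuous f} <-> forall e, 0 < e ->
    exists2 d, 0 < d & forall y, `|y - x| < d -> `|f y - f x| < e.
Proof.
split=> [/cvgrPdist_lt h e e0|h].
  have /nbhs_ballP[d /= d0 hd] := h e e0; exists d => // y yx.
  by rewrite distrC; apply: hd; rewrite -ball_normE /= distrC.
apply/cvgrPdist_lt => e e0; have [d d0 hd] := h e e0.
apply/nbhs_ballP; exists d => // y; rewrite -ball_normE /= => yx.
by rewrite distrC; apply: hd; rewrite distrC.
Qed.

Lemma nbhs_eps (x : V) (A : set V) :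
  nbhs x A <-> exists2 d, 0 < d & forall y, `|y - x| < d -> A y.
Proof.
split=> [/nbhs_ballP[d /= d0 hd]|[d d0 hd]].
  by exists d => // y yx; apply: hd; rewrite -ball_normE /= distrC.
apply/nbhs_ballP; exists d => //= y; rewrite -ball_normE /= => yx.
by apply: hd; rewrite distrC.
Qed.

End epsilon_delta.

Section row_norm.
Context {R : realType}.

Lemma coord_add d (x y : 'rV[R]_d) i : (x + y) 0 i = x 0 i + y 0 i.
Proof. by rewrite !mxE. Qed.

Lemma coord_sub d (x y : 'rV[R]_d) i : (x - y) 0 i = x 0 i - y 0 i.
Proof. by rewrite !mxE. Qed.

Lemma norm_coord_le d (v : 'rV[R]_d) i : `|v 0 i| <= `|v|.
Proof.
rewrite [leRHS]/Num.Def.normr /= mx_normrE; apply/bigmax_geP; right => /=.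
by exists (0, i).
Qed.

Lemma norm_row_le d (v : 'rV[R]_d) r :
  0 <= r -> (forall i, `|v 0 i| <= r) -> `|v| <= r.
Proof.
move=> r0 h; rewrite [leLHS]/Num.Def.normr /= mx_normrE; apply/bigmax_leP; split=> //=.
by move=> [i j] _ /=; rewrite ord1.
Qed.

Lemma norm_row_ge d (v : 'rV[R]_d) r :
  0 < r -> r <= `|v| -> exists i, r <= `|v 0 i|.
Proof.
move=> r0; rewrite [leRHS]/Num.Def.normr /= mx_normrE => /bigmax_geP /=[|].
  by rewrite leNgt r0.
by case=> -[a i] _ /=; rewrite ord1 => h; exists i.
Qed.

Lemma norm_lsubmx_le m n (v : 'rV[R]_(m + n)) : `|lsubmx v| <= `|v|.
Proof. by apply: norm_row_le => // i; rewrite mxE norm_coord_le. Qed.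

Lemma norm_rsubmx_le m n (v : 'rV[R]_(m + n)) : `|rsubmx v| <= `|v|.
Proof. by apply: norm_row_le => // i; rewrite mxE norm_coord_le. Qed.

Lemma norm_split_le m n (v : 'rV[R]_(m + n)) r :
  `|lsubmx v| <= r -> `|rsubmx v| <= r -> `|v| <= r.
Proof.
move=> hl hr; apply: norm_row_le => [|i]; first exact: le_trans hl.
rewrite -[v]hsubmxK mxE.
by case: (fintype.split i) => j; [apply: le_trans hl|apply: le_trans hr]; apply: norm_coord_le.
Qed.

Lemma bounded_cluster d (v : nat -> 'rV[R]_d) r : (forall k, `|v k| <= r) ->
  exists2 w, `|w| <= r &
    forall e N, 0 < e -> exists2 k, (N <= k)%N & `|v k - w| < e.
Proof.
move=> vr; pose A := [set w : 'rV[R]_d | `|w| <= r].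
have cA : compact A.
  apply: bounded_closed_compact; first by exists r; split; [exact: num_real|move=> s rs w]; move=> /le_trans; apply; exact: ltW.
  rewrite (_ : A = closed_ball_ Num.Def.normr 0 r); first exact: closed_closed_ball_.
  by apply/seteqP; split=> w; rewrite /closed_ball_ /A /= sub0r normrN.
have [|w [Aw clw]] := cA (v @ \oo) _; first by exists 0%N => // k _; exact: vr.
exists w => // e N e0.
have vN : (v @ \oo) [set v k | k in [set k | (N <= k)%N]].
  by exists N => // k Nk; exists k.
have [_ [[k Nk <-]]] := clw _ _ vN (nbhsx_ballx w _ e0).
by rewrite -ball_normE /= distrC => h; exists k.
Qed.

Lemma inv_nat_lt (e : R) : 0 < e -> exists N, forall k, (N <= k)%N -> k.+1%:R^-1 < e.
Proof.
move=> e0; exists (Num.truncn e^-1) => k hk.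
have : e^-1 < k.+1%:R by apply: lt_le_trans (truncnS_gt _) _; rewrite ler_nat ltnS.
by rewrite invf_plt ?posrE // ltr0n.
Qed.

End row_norm.

(** * The Poincare-Miranda theorem *)

Section poincare_miranda.
Context {R : realType}.

Definition cube_point m N (v : grid m N) : 'rV[R]_m :=
  \row_i (2 * (v i : nat)%:R / N.+1%:R - 1).

Lemma cube_point_bound m N (v : grid m N) : `|cube_point v| <= 1.
Proof.
apply: norm_row_le => // i; rewrite mxE ler_norml.
have /andP[] : (0 <= ((v i : nat)%:R / N.+1%:R : R) <= 1).
  by rewrite divr_ge0 ?ler0n //= ler_pdivrMr ?ltr0n // mul1r ler_nat -ltnS.
rewrite -mulrA; set a := _ / _ => a0 a1; apply/andP; split; lra.
Qed.

Lemma val_Zp_succ N (a : 'I_N.+2) : a != -1 -> (a + 1 : 'I_N.+2) = a.+1 :> nat.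
Proof.
move=> a1; have aN : (a.+1 < N.+2)%N.
  rewrite ltn_neqAle ltn_ord andbT; apply: contra a1 => /eqP[e].
  apply/eqP/val_inj; rewrite /= e.
  by rewrite /= modn_small // subn1.
by rewrite /= modnDmr addn1 modn_small.
Qed.

Lemma cube_point_cell m N (v u : grid m N) :
  (forall i, v i != -1) -> in_cell v u -> `|cube_point u - cube_point v| <= 2 / N.+1%:R.
Proof.
move=> v1 vu; apply: norm_row_le => [|i]; first by rewrite divr_ge0.
rewrite !mxE opprB addrA subrK -mulrBl -mulrBr normrM [`|_^-1|]ger0_norm ?invr_ge0 //.
rewrite ler_pM2r ?invr_gt0 ?ltr0n //.
case: (vu i) => ->; first by rewrite subrr mulr0 normr0.
rewrite val_Zp_succ // -[(v i).+1%:R]natr1.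
by rewrite addrAC subrr add0r mulr1 ger0_norm.
Qed.

(** Subdivide the cube and label a vertex by the signs of the components of [g]:
    the sign conditions are the boundary values required by [grid_cell], so each
    subdivision has a cell on which all components change sign.  A cluster point
    of these cells is a zero. *)
Lemma poincare_miranda m (g : 'rV[R]_m -> 'rV[R]_m) :
  (forall x, `|x| <= 1 -> {for x, continuous g}) ->
  (forall (x : 'rV[R]_m) i, `|x| <= 1 -> x 0 i = 1 -> 0 <= g x 0 i) ->
  (forall (x : 'rV[R]_m) i, `|x| <= 1 -> x 0 i = -1 -> g x 0 i <= 0) ->
  exists2 x, `|x| <= 1 & g x = 0.
Proof.
move=> gc gp gn.
have approx k : exists z : 'rV[R]_m, `|z| <= 1 /\ forall i, exists p q,
    [/\ `|p - z| <= 2 / k.+1%:R, `|q - z| <= 2 / k.+1%:R, 0 <= g p 0 i & g q 0 i <= 0].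
  (* the label is forced on the faces, where the component of [g] may vanish *)
  pose l i (v : grid m k) := (v i == -1) || (v i != 0) && (0 < g (cube_point v) 0 i).
  have l0 i (v : grid m k) : v i = 0 -> l i v = false.
    by move=> vi; rewrite /l vi eqxx orbF eq_sym oppr_eq0 oner_eq0.
  have l1 i (v : grid m k) : v i = -1 -> l i v = true by move=> vi; rewrite /l vi eqxx.
  have [v v1 hv] := grid_cell l0 l1.
  exists (cube_point v); split=> [|i]; first exact: cube_point_bound.
  have [u [u' [cu cu' lu lu']]] := hv i.
  exists (cube_point u), (cube_point u'); split; try exact: cube_point_cell.
  - case/orP: lu => [/eqP ui|/andP[_ /ltW//]]; apply: gp; first exact: cube_point_bound.
    rewrite mxE ui /= modn_small ?subn1 // mulfK ?pnatr_eq0 //.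
    by rewrite -(natrB _ (n := 1)).
  - move: lu'; rewrite /l negb_or negb_and negbK -leNgt => /andP[_ /orP[/eqP ui|//]].
    apply: gn; first exact: cube_point_bound.
    by rewrite mxE ui /= mulr0 mul0r sub0r.
have [z hz] := choice approx.
have [w w1 clw] := bounded_cluster (fun k => (hz k).1).
have near d : 0 < d -> forall i, (exists2 p, `|p - w| < d & 0 <= g p 0 i) /\
                                (exists2 q, `|q - w| < d & g q 0 i <= 0).
  move=> d0 i; have d4 : 0 < d / 4 by rewrite divr_gt0.
  have [N hN] := inv_nat_lt d4; have [k Nk kw] := clw _ N d4.
  have [_ /(_ i)[p [q [pz qz gp0 gq0]]]] := hz k.
  have := hN k Nk => hk.
  have close a : `|a - z k| <= 2 / k.+1%:R -> `|a - w| < d.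
    move=> az; rewrite -(subrK (z k) a) -addrA.
    apply: le_lt_trans (ler_normD _ _) _; move: az hk kw.
    by set c := _^-1; move: `|a - _| `|_ - w| => ? ?; lra.
  by split; [exists p|exists q] => //; apply: close.
exists w => //; apply/rowP => i; rewrite mxE.
apply/eqP; apply: contraT => gw0.
have e0 : 0 < `|g w 0 i| by rewrite normr_gt0.
have [d d0 hd] := (continuous_eps_delta g w).1 (gc w w1) _ e0.
have [[p pw gp0] [q qw gq0]] := near d d0 i.
have := le_lt_trans (norm_coord_le _ i) (hd p pw).
have := le_lt_trans (norm_coord_le _ i) (hd q qw).
rewrite !mxE; case: (ltP 0 (g w 0 i)) => gw.
  by rewrite (gtr0_norm gw) distrC => /(le_lt_trans (ler_norm _)); lra.
by rewrite (ler0_norm gw) => _ /(le_lt_trans (ler_norm _)); lra.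
Qed.

End poincare_miranda.

(** * Lipschitz images of spheres *)

Section lipschitz_image_of_sphere.
Context {R : realType}.

Definition unit_bin (N : nat) (a : R) : 'I_N.+1 := inord (Num.truncn (a * N%:R)).

Lemma unit_bin_eq N (a b : R) : (0 < N)%N -> 0 <= a <= 1 -> 0 <= b <= 1 ->
  unit_bin N a = unit_bin N b -> `|a - b| <= N%:R^-1.
Proof.
move=> N0 /andP[a0 a1] /andP[b0 b1] /(congr1 val) /=.
have NR : 0 < N%:R :> R by rewrite ltr0n.
have lt c : 0 <= c -> c <= 1 -> (Num.truncn (c * N%:R) < N.+1)%N.
  move=> c0 c1; rewrite truncn_lt_nat ?mulr_ge0// ?ler0n//.
  apply: le_lt_trans (_ : _ <= N%:R) _; last by rewrite ltr_nat.
  by rewrite ler_piMl // ltW.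
rewrite !inordK ?lt // => e.
have /andP[a2 a3] := truncn_itv (mulr_ge0 a0 (ltW NR)).
have /andP[b2 b3] := truncn_itv (mulr_ge0 b0 (ltW NR)).
rewrite -(ler_pM2r NR) mulVf ?gt_eqF // -{1}(ger0_norm (ltW NR)) -normrM mulrBl.
move: a2 a3 b2 b3; rewrite e -natr1 => a2 a3 b2 b3.
by rewrite ler_norml; lra.
Qed.

Lemma pigeonhole (T T' : finType) (f : T -> T') :
  (#|T'| < #|T|)%N -> exists x y, x != y /\ f x = f y.
Proof.
move=> lt; have /injectivePn[x [y xy e]] : ~~ injectiveb f.
  by apply/negP => /injectiveP /leq_card; rewrite leqNgt lt.
by exists x, y.
Qed.

(** A sphere of the sup norm is the boundary of a cube: a point is located by a
    face, that is a coordinate and its sign, and by a cell of that face. *)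
Definition sphere_code m N (e : R) (y : 'rV[R]_m.+1) :
    'I_m.+1 * bool * {ffun 'I_m -> 'I_N.+1} :=
  let j := xget ord0 [set j | `|y 0 j| = e] in
  (j, 0 < y 0 j, [ffun i => unit_bin N ((y 0 (lift j i) + e) / (2 * e))]).

Lemma sphere_code_eq m N e (y z : 'rV[R]_m.+1) :
  0 < e -> (0 < N)%N -> `|y| = e -> `|z| = e -> sphere_code N e y = sphere_code N e z ->
  `|y - z| <= 2 * e / N%:R.
Proof.
move=> e0 N0 ye ze; rewrite /sphere_code.
have face (w : 'rV[R]_m.+1) : `|w| = e -> exists j, `|w 0 j| = e.
  move=> we; have [|j hj] := @norm_row_ge R _ w e e0; first by rewrite we.
  by exists j; apply/eqP; rewrite eq_le hj -{1}we norm_coord_le.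
case: xgetP => [j _ yj|]; last by have [j yj] := face y ye => /(_ j).
case: xgetP => [j' _ zj|]; last by have [j' zj] := face z ze => /(_ j').
case=> jj' sgn /ffunP hbin; move: zj sgn hbin; rewrite -{j'}jj' => zj sgn hbin.
have r0 : 0 <= 2 * e / N%:R by rewrite divr_ge0// mulr_ge0// ltW.
apply: norm_row_le => // i; rewrite mxE mxE.
have [i'|->] := unliftP j i; last first.
  suff -> : y 0 j = z 0 j by rewrite subrr normr0.
  move: sgn; case: (ltrP 0 (y 0 j)) => yj0; case: (ltrP 0 (z 0 j)) => zj0 // _.
    by rewrite -(gtr0_norm yj0) -(gtr0_norm zj0) yj zj.
  by apply: oppr_inj; rewrite -(ler0_norm yj0) -(ler0_norm zj0) yj zj.
move=> ->; have := hbin i'; rewrite !ffunE.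
have in01 (w : 'rV[R]_m.+1) k : `|w| = e -> 0 <= (w 0 k + e) / (2 * e) <= 1.
  move=> we; have := norm_coord_le w k; rewrite we ler_norml => /andP[h1 h2].
  by rewrite divr_ge0 ?ler_pdivrMr; lra.
move=> /(unit_bin_eq N0 (in01 _ _ ye) (in01 _ _ ze)).
rewrite -mulrBl opprD addrACA subrr addr0 normrM [`|_^-1|]ger0_norm; last first.
  by rewrite invr_ge0 mulr_ge0// ltW.
by rewrite ler_pdivrMr ?mulr_gt0 // mulrC.
Qed.

(** Dimension count.  A sphere is covered by about [N ^ m.-1] cells of size [1 / N],
    whereas a ball contains [K ^ m] points at mutual distances at least [d / K].
    With [N = A * K] for a suitable constant [A] and [K] large, two of these
    points would have preimages in one cell, which contradicts the Lipschitz
    bound. *)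
Lemma lipschitz_sphere_misses m (P : 'rV[R]_m -> 'rV[R]_m) (c : 'rV[R]_m) (e L d : R) :
  0 < e -> 0 < L -> 0 < d -> (forall y z, `|P y - P z| <= L * `|y - z|) ->
  exists2 s, `|s| <= d & forall y, `|y - c| = e -> P y != s.
Proof.
case: m P c => [|m] P c e0 L0 d0 PL.
  exists 0; first by rewrite normr0 ltW.
  move=> y /eqP; suff -> : y - c = 0 by rewrite normr0 lt_eqF.
  by apply/rowP => -[].
apply: contrapT => no.
pose A := (Num.truncn (2 * e * L / d)).+1.
have hA : 2 * e * L / d < A%:R by apply: truncnS_gt.
(* the number of cells is at most [2 * m.+1 * (2 * A * K) ^ m], below [K ^ m.+1] *)
pose K := (2 * m.+1 * (2 * A) ^ m).+1.
have K0 : 0 < K%:R :> R by rewrite ltr0n.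
pose pt (t : {ffun 'I_m.+1 -> 'I_K}) : 'rV[R]_m.+1 := \row_i (d * (t i : nat)%:R / K%:R).
have pt_le t : `|pt t| <= d.
  apply: norm_row_le => [|i]; first exact: ltW.
  rewrite mxE ger0_norm; last by rewrite divr_ge0 // mulr_ge0 // ltW.
  by rewrite ler_pdivrMr // ler_pM2l // ler_nat ltnW.
have /choice[y hy] t : exists y, `|y - c| = e /\ P y = pt t.
  apply: contrapT => h; apply: no; exists (pt t) => // y yc.
  by apply/eqP => Py; apply: h; exists y.
have N0 : (0 < A * K)%N by [].
have [|t [t' [tt']]] := @pigeonhole _ _ (fun t => sphere_code (A * K) e (y t - c)).
  rewrite !card_prod !card_ffun !card_ord card_bool.
  have le : ((A * K).+1 ^ m <= (2 * A * K) ^ m)%N.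
    have expW a b k : (a <= b -> a ^ k <= b ^ k)%N.
      by move=> ab; elim: k => // k IH; rewrite !expnS leq_mul.
    by apply: expW; rewrite -mulnA mul2n -addnn -add1n leq_add2r.
  apply: leq_ltn_trans (_ : _ <= m.+1 * 2 * (2 * A * K) ^ m)%N _; first by rewrite leq_mul2l le orbT.
  by rewrite expnMn mulnA [X in (_ < X)%N]expnS ltn_mul2r expn_gt0 /= /K (mulnC m.+1).
move=> /(sphere_code_eq e0 N0 (hy t).1 (hy t').1).
rewrite opprB addrA subrK => close.
have [i ti] : exists i, t i != t' i.
  by apply/existsP; rewrite -negb_forall; apply: contra tt' => /forallP h; apply/eqP/ffunP => i; exact/eqP.
have far : d / K%:R <= `|pt t - pt t'|.
  apply: le_trans (norm_coord_le _ i); rewrite !mxE -mulrBl -mulrBr !normrM.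
  rewrite (gtr0_norm d0) [`|_^-1|]gtr0_norm ?invr_gt0 // -mulrA ler_pM2l //.
  rewrite -[leLHS]mul1r ler_pM2r ?invr_gt0 //.
  move: ti; rewrite -val_eqE /= neq_ltn => /orP[] lt.
    by rewrite distrC ger0_norm -?natrB 1?ltnW // ?ler1n ?subn_gt0 // ler0n.
  by rewrite ger0_norm -?natrB 1?ltnW // ?ler1n ?subn_gt0 // ler0n.
have := le_trans far; rewrite -(hy t).2 -(hy t').2 => /(_ _ (PL _ _)).
apply/negP; rewrite -ltNge.
apply: le_lt_trans (_ : _ <= L * (2 * e / (A * K)%:R)) _; first by rewrite ler_pM2l.
rewrite natrM invfM !mulrA ltr_pM2r ?invr_gt0 // ltr_pdivrMr ?ltr0n //.
by move: hA; rewrite ltr_pdivrMr // (mulrC d) mulrAC (mulrC L) mulrAC.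
Qed.

End lipschitz_image_of_sphere.

(** * Invariance of domain *)

Section invariance_of_domain.
Context {R : realType} (m : nat).
Implicit Types (x y z : 'rV[R]_m) (h : 'rV[R]_m -> 'rV[R]_m).

(** By compactness, the inverse of an injective continuous map on the cube is
    uniformly continuous. *)
Lemma injective_uniformly_on_cube h d :
  (forall x, `|x| <= 1 -> {for x, continuous h}) ->
  (forall x y, `|x| <= 1 -> `|y| <= 1 -> h x = h y -> x = y) -> 0 < d ->
  exists2 k, 0 < k & forall x y, `|x| <= 1 -> `|y| <= 1 -> d <= `|x - y| ->
    k <= `|h x - h y|.
Proof.
move=> hc hi d0; apply: contrapT => no.
have /choice[p hp] (k : nat) : exists p : 'rV[R]_m * 'rV[R]_m,
    [/\ `|p.1| <= 1, `|p.2| <= 1, d <= `|p.1 - p.2| & `|h p.1 - h p.2| < k.+1%:R^-1].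
  apply: contrapT => np; apply: no; exists k.+1%:R^-1 => [|x y x1 y1 xy].
    by rewrite invr_gt0 ltr0n.
  by rewrite leNgt; apply/negP => lt; apply: np; exists (x, y).
pose q k := row_mx (p k).1 (p k).2.
have ql k : `|q k| <= 1.
  by have [? ? _ _] := hp k; apply: norm_split_le; rewrite ?row_mxKl ?row_mxKr.
have [w w1 clw] := bounded_cluster ql.
have l1 := le_trans (norm_lsubmx_le w) w1; have r1 := le_trans (norm_rsubmx_le w) w1.
have near e N : 0 < e -> exists k, [/\ (N <= k)%N, `|(p k).1 - lsubmx w| < e
    & `|(p k).2 - rsubmx w| < e].
  move=> e0; have [k Nk kw] := clw e N e0; exists k; split=> //.
    have := norm_lsubmx_le (q k - w); rewrite raddfB /= row_mxKl; move/le_lt_trans; exact.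
  have := norm_rsubmx_le (q k - w); rewrite raddfB /= row_mxKr; move/le_lt_trans; exact.
have hlr : h (lsubmx w) = h (rsubmx w).
  apply/eqP; rewrite -subr_eq0 -normr_eq0; apply: contraT => ne.
  have e0 : 0 < `|h (lsubmx w) - h (rsubmx w)| / 3.
    by rewrite divr_gt0 // lt_neqAle eq_sym ne normr_ge0.
  have [d1 d10 hd1] := (continuous_eps_delta _ _).1 (hc _ l1) _ e0.
  have [d2 d20 hd2] := (continuous_eps_delta _ _).1 (hc _ r1) _ e0.
  have [N hN] := inv_nat_lt e0.
  have m0 : 0 < Num.min d1 d2 by rewrite lt_min d10.
  have [k [Nk]] := near _ N m0; rewrite !lt_min => /andP[k1 _] /andP[_ k2].
  have := hd1 _ k1; have := hd2 _ k2; have := hN k Nk; have [_ _ _] := hp k.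
  set a := h (p k).1; set b := h (p k).2; set u := h _; set v := h _.
  have : `|u - v| <= `|a - u| + `|a - b| + `|b - v|.
    have := ler_distD a u v; have := ler_distD b a v; rewrite (distrC u a); lra.
  move: (_^-1) `|u - v| `|a - u| `|a - b| `|b - v| => A B C D E ? ? ? ? ?.
  lra.
have d30 : 0 < d / 3 by rewrite divr_gt0.
have [k [_ k1 k2]] := near _ 0%N d30; have [_ _ + _] := hp k.
rewrite leNgt => /negP[]; move: k1 k2; rewrite (hi _ _ l1 r1 hlr).
set a := (p k).1; set b := (p k).2; set u := rsubmx w => k1 k2.
by have := ler_distD u a b; rewrite (distrC u) => /le_lt_trans; apply; lra.
Qed.

(** A globally Lipschitz substitute for the inverse of [h] on the cube: the
    inf-convolution of its coordinates with [L * |.|].  It provides at once the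
    extension of the inverse to the whole space and its Lipschitz
    approximation. *)
Definition inf_conv h (L : R) (y : 'rV[R]_m) : 'rV[R]_m :=
  \row_i inf [set x 0 i + L * `|y - h x| | x in [set x : 'rV[R]_m | `|x| <= 1]].

Lemma inf_conv_le h L y x i : 0 <= L -> `|x| <= 1 ->
  inf_conv h L y 0 i <= x 0 i + L * `|y - h x|.
Proof.
move=> L0 x1; rewrite mxE; apply: ge_inf; last by exists x.
exists (-1) => _ [z z1 <-]; have := le_trans (norm_coord_le z i) z1.
rewrite ler_norml => /andP[+ _]; move/le_trans; apply.
by rewrite lerDl mulr_ge0.
Qed.

Lemma inf_conv_ge h L y i a :
  (forall x, `|x| <= 1 -> a <= x 0 i + L * `|y - h x|) -> a <= inf_conv h L y 0 i.
Proof.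
move=> ha; rewrite mxE; apply: lb_le_inf; last by move=> _ [x x1 <-]; exact: ha.
by eexists; exists 0 => //=; rewrite normr0.
Qed.

Lemma inf_conv_lipschitz h L y z : 0 <= L ->
  `|inf_conv h L y - inf_conv h L z| <= L * `|y - z|.
Proof.
move=> L0; have half u v i : inf_conv h L u 0 i - inf_conv h L v 0 i <= L * `|u - v|.
  rewrite lerBlDr addrC -lerBlDr; apply: inf_conv_ge => x x1; rewrite lerBlDr.
  apply: le_trans (inf_conv_le _ _ _ L0 x1) _.
  by rewrite -addrA lerD2l -mulrDr ler_wpM2l //; have := ler_distD v u (h x); lra.
apply: norm_row_le => [|i]; first by rewrite mulr_ge0.
by rewrite coord_sub ler_norml half andbT lerNl opprB distrC half.
Qed.

(** If [L] is large, a point at distance at least [d] from [x] is penalized by at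
    least 2, the diameter of the cube, and so does not lower the infimum. *)
Lemma inf_conv_approx h L d x : 0 <= L -> 0 <= d ->
  (forall x y, `|x| <= 1 -> `|y| <= 1 -> d <= `|x - y| -> 2 <= L * `|h x - h y|) ->
  `|x| <= 1 -> `|inf_conv h L (h x) - x| <= d.
Proof.
move=> L0 d0 hL x1; apply: norm_row_le => // i; rewrite coord_sub ler_norml.
rewrite lerBlDr (le_trans (inf_conv_le _ _ _ L0 x1)) ?subrr ?normr0 ?mulr0 ?addr0 ?lerDr // andbT.
rewrite lerBrDr; apply: inf_conv_ge => y y1; have [xy|xy] := leP d `|x - y|.
  have := hL x y x1 y1 xy; have := le_trans (norm_coord_le x i) x1.
  have := le_trans (norm_coord_le y i) y1; rewrite !ler_norml.
  by move=> /andP[? ?] /andP[? ?]; lra.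
have := le_lt_trans (norm_coord_le (x - y) i) xy; rewrite coord_sub ltr_norml.
have : 0 <= L * `|h x - h y| by rewrite mulr_ge0.
by move=> ? /andP[? ?]; lra.
Qed.

(** Fixes the points at distance at least [e] from [c] and moves the other points
    radially to the sphere of radius [e]; continuous everywhere but at [c]. *)
Definition push_away (c : 'rV[R]_m) (e : R) (y : 'rV[R]_m) : 'rV[R]_m :=
  c + Num.max (e / `|y - c|) 1 *: (y - c).

Lemma push_away_out c e y : 0 < e -> e <= `|y - c| -> push_away c e y = y.
Proof.
move=> e0 ey; have y0 := lt_le_trans e0 ey.
rewrite /push_away max_r; first by rewrite scale1r addrC subrK.
by rewrite ler_pdivrMr // mul1r.
Qed.

Lemma push_away_in c e y : 0 < e -> y != c -> `|y - c| <= e -> `|push_away c e y - c| = e.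
Proof.
move=> e0 yc ye; have y0 : 0 < `|y - c| by rewrite normr_gt0 subr_eq0.
have le1 : 1 <= e / `|y - c| by rewrite ler_pdivlMr // mul1r.
rewrite /push_away max_l // addrC addKr normrZ ger0_norm ?divr_ge0 ?ltW //.
by rewrite divfK // gt_eqF.
Qed.

Lemma push_away_continuous c e y : y != c -> {for y, continuous (push_away c e)}.
Proof.
move=> yc; have cB : {for y, continuous (fun z : 'rV[R]_m => z - c)}.
  exact: (cvgB (@cvg_id _ (nbhs y)) (cvg_cst c)).
have cM : {for y, continuous (fun z : 'rV[R]_m => Num.max (e / `|z - c|) 1 : R)}.
  have cN : {for y, continuous (fun z : 'rV[R]_m => e / `|z - c| : R)}.
    apply: (cvgM (cvg_cst e) (cvgV _ (cvg_norm cB))).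
    by rewrite normr_eq0 subr_eq0.
  exact: (@continuous_max R _ (fun z => e / `|z - c|) (cst 1) y cN (@cst_continuous _ _ _ _)).
exact: (cvgD (cvg_cst c) (cvgZ cM cB)).
Qed.

(** If [c] were omitted, the map [g] of the proof would contradict the
    Poincare-Miranda theorem.  The radius [e] is such that the boundary of the
    cube is sent outside the ball of radius [e] around [c]; there [push_away] is
    the identity and [g] is close to the identity. *)
Lemma invariance_of_domain_unit h :
  (forall x, `|x| <= 1 -> {for x, continuous h}) ->
  (forall x y, `|x| <= 1 -> `|y| <= 1 -> h x = h y -> x = y) ->
  exists2 r, 0 < r & forall c, `|c - h 0| < r -> exists2 x, `|x| <= 1 & h x = c.
Proof.
move=> hc hi; have n0 : `|0 : 'rV[R]_m| <= 1 by rewrite normr0.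
have [k k0 hk] := injective_uniformly_on_cube hc hi ltr01.
pose e := k / 2; have e0 : 0 < e by rewrite divr_gt0.
exists e => // c ce; apply: contrapT => no.
have hxc x : `|x| <= 1 -> h x != c by move=> x1; apply/eqP => hx; apply: no; exists x.
have bdry x : `|x| <= 1 -> 1 <= `|x| -> e <= `|h x - c|.
  move=> x1 x1'; have := hk x 0 x1 n0; rewrite subr0 => /(_ x1').
  have := ler_distD c (h x) (h 0).
  by move: ce; rewrite /e; lra.
(* a neighbourhood of 0 is sent into the ball, so outside the ball [x] is not small *)
have [mu mu0 hmu] : exists2 mu, 0 < mu & mu <= 1 /\ forall x, `|x| < mu -> `|h x - c| < e.
  have e1 : 0 < e - `|c - h 0| by rewrite subr_gt0.
  have [d d0 hd] := (continuous_eps_delta h 0).1 (hc 0 n0) _ e1.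
  exists (Num.min d 1); first by rewrite lt_min d0 ltr01.
  split; first by rewrite ge_min lexx orbT.
  move=> x; rewrite lt_min => /andP[xd _].
  have := hd x; rewrite subr0 => /(_ xd).
  by have := ler_distD (h 0) (h x) c; rewrite (distrC (h 0) c); lra.
have [mu1 hmu'] := hmu.
pose d := mu / 3; have d0 : 0 < d by rewrite divr_gt0.
have [kd kd0 hkd] := injective_uniformly_on_cube hc hi d0.
pose L := 2 / kd; have L0 : 0 < L by rewrite divr_gt0.
have hL x y : `|x| <= 1 -> `|y| <= 1 -> d <= `|x - y| -> 2 <= L * `|h x - h y|.
  by move=> x1 y1 xy; rewrite /L -mulrA ler_peMr // mulrC ler_pdivlMr // mul1r hkd.
pose P := inf_conv h L.
have PL y z := inf_conv_lipschitz h y z (ltW L0).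
have Papp x := inf_conv_approx (ltW L0) (ltW d0) hL (x := x).
have [s sd hs] := lipschitz_sphere_misses c e0 L0 d0 PL.
have sd' i : `|s 0 i| <= d := le_trans (norm_coord_le s i) sd.
have Pc y : {for y, continuous P}.
  apply/continuous_eps_delta => a a0; exists (a / L); first by rewrite divr_gt0.
  by move=> z zy; apply: le_lt_trans (PL _ _) _; rewrite mulrC -ltr_pdivlMr.
pose g x := P (push_away c e (h x)) - s.
have gE x : `|x| <= 1 -> e <= `|h x - c| -> `|g x + s - x| <= d.
  by move=> x1 xc; rewrite /g subrK push_away_out //; exact: Papp.
have gEi x i : `|x| <= 1 -> 1 <= `|x| -> `|g x 0 i + s 0 i - x 0 i| <= d.
  move=> x1 x1'; apply: le_trans (gE x x1 (bdry x x1 x1')).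
  by have := norm_coord_le (g x + s - x) i; rewrite coord_sub coord_add.
have [|||x x1 gx] := @poincare_miranda R m g.
- move=> x x1; suff cx : {for x, continuous ((P \o push_away c e) \o h)}.
    exact: (cvgB cx (cvg_cst s)).
  apply: continuous_comp; first exact: hc.
  apply: continuous_comp; last exact: Pc.
  by apply: push_away_continuous; exact: hxc.
- move=> x i x1 xi; have := gEi x i x1; have := norm_coord_le x i; rewrite xi normr1.
  move=> h1 /(_ h1); rewrite ler_norml; have := sd' i; rewrite ler_norml.
  by rewrite /d => /andP[? ?] /andP[? ?]; lra.
- move=> x i x1 xi; have := gEi x i x1; have := norm_coord_le x i; rewrite xi normrN1.
  move=> h1 /(_ h1); rewrite ler_norml; have := sd' i; rewrite ler_norml.
  by rewrite /d => /andP[? ?] /andP[? ?]; lra.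
have Ps : P (push_away c e (h x)) = s by apply/eqP; rewrite -subr_eq0; apply/eqP.
have [xe|xe] := leP e `|h x - c|.
  have := gE x x1 xe; rewrite gx add0r; have [xm|xm] := ltP `|x| mu.
    by have := hmu' x xm; lra.
  have := ler_distD s x 0; rewrite !subr0 (distrC x); move: sd; rewrite /d; lra.
by have := hs _ (push_away_in e0 (hxc x x1) (ltW xe)); rewrite -/P Ps eqxx.
Qed.

End invariance_of_domain.

Lemma invariance_of_domain (R : realType) m (h : 'rV[R]_m -> 'rV[R]_m) (t0 : 'rV[R]_m) r :
  0 < r ->
  (forall t, `|t - t0| <= r -> {for t, continuous h}) ->
  (forall t t', `|t - t0| <= r -> `|t' - t0| <= r -> h t = h t' -> t = t') ->
  exists2 e, 0 < e & forall c, `|c - h t0| < e -> exists2 t, `|t - t0| <= r & h t = c.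
Proof.
move=> r0 hc hi; pose k (x : 'rV[R]_m) := t0 + r *: x.
have kr x : `|x| <= 1 -> `|k x - t0| <= r.
  by move=> x1; rewrite /k addrC addKr normrZ gtr0_norm // ler_piMr // ltW.
have [||e e0 he] := @invariance_of_domain_unit R m (h \o k).
- move=> x x1; apply: continuous_comp; last by apply: hc; exact: kr.
  exact: (cvgD (cvg_cst t0) (cvgZ (cvg_cst r) (@cvg_id _ (nbhs x)))).
- move=> x y x1 y1 /(hi _ _ (kr _ x1) (kr _ y1)) /addrI /eqP.
  by rewrite -subr_eq0 -scalerBr scaler_eq0 gt_eqF //= subr_eq0 => /eqP.
exists e => // c ce; have [|x x1 hx] := he c; first by rewrite /= /k scaler0 addr0.
by exists (k x) => //; exact: kr.
Qed.

(** * Strict differentiability of maps of class C^1 *)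

Section C1_strict.
Context {R : realType}.

Lemma is_derive_line d e (f : 'rV[R]_d -> 'rV[R]_e) (y v : 'rV[R]_d) i (t : R) :
  differentiable f (y + t *: v) ->
  is_derive t 1 (fun s : R => f (y + s *: v) 0 i) ('d f (y + t *: v) v 0 i).
Proof.
move=> df; have dv : derivable f (y + t *: v) v by exact: diff_derivable.
set w := y + t *: v in df dv *.
have c1 : (fun h : R => h^-1 *: (f (h *: v + w) - f w)) @ 0^' --> 'd f w v.
  by rewrite -deriveE //; exact: dv.
have c2 : (fun h : R => (h^-1 *: (f (h *: v + w) - f w)) 0 i) @ 0^' --> 'd f w v 0 i.
  exact: (cvg_comp _ _ c1 (@coord_continuous _ _ _ _ _ _)).
set phi := fun s : R => _.
have c4 : (fun h : R => h^-1 *: (phi (h *: 1 + t) - phi t)) @ 0^' --> 'd f w v 0 i.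
  apply: cvg_trans c2; apply: near_eq_cvg; near=> h.
  rewrite /phi /= -[h%:A]/(h * 1) mulr1.
  have -> : y + (h + t) *: v = h *: v + w by rewrite scalerDl addrCA.
  by rewrite !mxE.
split; first exact: (cvgP _ c4).
exact: (cvg_lim _ c4).
Unshelve. all: by end_near.
Qed.

Lemma mean_value_coord d e (f : 'rV[R]_d -> 'rV[R]_e) (y z : 'rV[R]_d) i :
  (forall t : R, 0 <= t <= 1 -> differentiable f (y + t *: (z - y))) ->
  exists2 t : R, 0 <= t <= 1 & f z 0 i - f y 0 i = 'd f (y + t *: (z - y)) (z - y) 0 i.
Proof.
move=> df; pose phi (s : R) := f (y + s *: (z - y)) 0 i.
have d1 (t : R) : 0 <= t <= 1 -> is_derive t 1 phi ('d f (y + t *: (z - y)) (z - y) 0 i).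
  by move=> /df; exact: is_derive_line.
have [||t t01] := @MVT_segment R phi (fun t => 'd f (y + t *: (z - y)) (z - y) 0 i) 0 1 ler01.
- by move=> t; rewrite in_itv /= => /andP[? ?]; apply: d1; rewrite !ltW.
- apply: derivable_within_continuous => t; rewrite in_itv /= => t01.
  by have := d1 t t01 => -[].
rewrite /phi scale1r scale0r addr0 (addrC y) subrK subr0 mulr1 => e1.
by exists t; move: t01; rewrite ?in_itv.
Qed.

(** Reduces a uniform estimate on linear maps to the finitely many vectors of the
    canonical basis, on which the continuity of partial derivatives is known. *)
Lemma linear_sub_bound d e (L1 L2 : {linear 'rV[R]_d -> 'rV[R]_e}) (eta : R) v :
  (forall j, `|L1 (delta_mx 0 j) - L2 (delta_mx 0 j)| <= eta) ->
  `|L1 v - L2 v| <= d%:R * eta * `|v|.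
Proof.
have lin (L : {linear 'rV[R]_d -> 'rV[R]_e}) :
    L v = \sum_j v 0 j *: L (delta_mx 0 j).
  by rewrite {1}(row_sum_delta v) linear_sum; apply: eq_bigr => j _; rewrite linearZ.
move=> hL; rewrite !lin -sumrB.
apply: le_trans (ler_norm_sum _ _ _) _.
rewrite -mulrA -[X in X%:R]card_ord mulr_natl -sumr_const; apply: ler_sum => j _.
by rewrite -scalerBr normrZ mulrC ler_pM //; exact: norm_coord_le.
Qed.

(** Mean value inequality for [f - 'd f p] on a small ball: the increment of a
    coordinate of [f] is the value of ['d f w] for some [w] in the ball, and
    ['d f w] is uniformly close to ['d f p]. *)
Lemma C1_strictly_differentiable d e (U : set 'rV[R]_d) (f : 'rV[R]_d -> 'rV[R]_e) p :
  open U -> class_C 1 U f -> U p -> forall eps, 0 < eps ->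
  exists2 r, 0 < r & forall y z, `|y - p| < r -> `|z - p| < r ->
    `|f z - f y - 'd f p (z - y)| <= eps * `|z - y|.
Proof.
move=> oU [fd fc] Up eps eps0; pose eta := eps / d.+1%:R.
have eta0 : 0 < eta by rewrite divr_gt0 // ltr0n.
have [r r0 hr] : exists2 r, 0 < r & forall w, `|w - p| < r ->
    U w /\ forall j : 'I_d, `|'d f w (delta_mx 0 j) - 'd f p (delta_mx 0 j)| < eta.
  have nU : nbhs p U by exact: open_nbhs_nbhs.
  have nj (j : 'I_d) : nbhs p [set w | `|'d f w (delta_mx 0 j) - 'd f p (delta_mx 0 j)| < eta].
    by apply/nbhs_eps; exact: (continuous_eps_delta _ _).1 (fc (delta_mx 0 j) p Up) _ eta0.
  have [r r0 hr] := (nbhs_eps _ _).1 (filterI nU (filter_forall _ nj)).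
  by exists r.
exists r => // y z yp zp.
have seg (t : R) : 0 <= t <= 1 -> `|y + t *: (z - y) - p| < r.
  move=> /andP[t0 t1].
  have -> : y + t *: (z - y) - p = (1 - t) *: (y - p) + t *: (z - p).
    by rewrite !scalerBr !scalerBl !scale1r; apply/rowP => i; rewrite !mxE; ring.
  apply: le_lt_trans (ler_normD _ _) _; rewrite !normrZ !ger0_norm ?subr_ge0 //.
  have [->|tn0] := eqVneq t 0; first by rewrite subr0 mul1r mul0r addr0.
  have tp : 0 < t by rewrite lt_neqAle eq_sym tn0.
  have : (1 - t) * `|y - p| <= (1 - t) * r by rewrite ler_wpM2l ?subr_ge0 // ltW.
  have : t * `|z - p| < t * r by rewrite ltr_pM2l.
  lra.
apply: norm_row_le => [|i]; first by rewrite mulr_ge0 // ltW.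
have [t t01 mv] := @mean_value_coord _ _ f y z i (fun t ht => fd _ (hr _ (seg t ht)).1).
have [_ hw] := hr _ (seg t t01).
set w := y + t *: (z - y) in mv hw.
have -> : (f z - f y - 'd f p (z - y)) 0 i = ('d f w (z - y) - 'd f p (z - y)) 0 i.
  by rewrite !coord_sub mv.
apply: le_trans (norm_coord_le _ _) _.
apply: le_trans (linear_sub_bound _ (fun j => ltW (hw j))) _.
rewrite ler_wpM2r // /eta mulrCA ler_piMr ?ltW //.
by rewrite ltr_pdivrMr ?ltr0n // mul1r ltr_nat.
Qed.
End C1_strict.

(** * Differentials, linear maps and smoothness *)

Section differential_eps.
Context {R : realType} {V W : normedModType R}.

Lemma diff_eps (f : V -> W) (x : V) : differentiable f x ->
  forall e, 0 < e -> exists2 r, 0 < r &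
    forall y, `|y - x| < r -> `|f y - f x - 'd f x (y - x)| <= e * `|y - x|.
Proof.
move=> /diff_locally /eqaddoP df e e0; have [r r0 hr] := (nbhs_eps _ _).1 (df e e0).
exists r => // y yx; have := hr (y - x); rewrite subr0 => /(_ yx).
by rewrite /= -[(_ - _) (y - x)]/(f (y - x + x) - (f x + 'd f x (y - x))) subrK opprD addrA.
Qed.

Lemma diff_eps_unique (f : V -> W) (x : V) (L : {linear V -> W}) : continuous L ->
  (forall e, 0 < e -> exists2 r, 0 < r &
    forall y, `|y - x| < r -> `|f y - f x - L (y - x)| <= e * `|y - x|) ->
  differentiable f x /\ 'd f x = L :> (V -> W).
Proof.
move=> cL h; have hL : f \o shift x = cst (f x) + L +o_ 0 id.
  apply/eqaddoP => e e0; have [r r0 hr] := h e e0.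
  apply/nbhs_eps; exists r => // y; rewrite subr0 => yr.
  have := hr (y + x); rewrite addrK => /(_ yr) /=.
  by rewrite -[(_ - _) y]/(f (y + x) - (f x + L y)) opprD addrA.
have dE := diff_unique cL hL; split=> //.
by apply/diff_locallyP; rewrite dE.
Qed.

Lemma eq_on_open_diff (f g : V -> W) (x : V) (U : set V) : open U -> U x ->
  (forall y, U y -> f y = g y) -> differentiable f x ->
  differentiable g x /\ 'd g x = 'd f x :> (V -> W).
Proof.
move=> oU Ux fg df; apply: diff_eps_unique; first exact: diff_continuous.
move=> e e0; have [r r0 hr] := diff_eps df e0.
have [s s0 hs] := (nbhs_eps _ _).1 (open_nbhs_nbhs (conj oU Ux)).
exists (Num.min r s); first by rewrite lt_min r0.
move=> y; rewrite lt_min => /andP[yr ys].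
by rewrite -!fg //; [exact: hr|exact: hs].
Qed.

End differential_eps.

Section linear_maps.
Context {R : realType}.

Lemma linear_row_continuous d e (L : {linear 'rV[R]_d -> 'rV[R]_e}) : continuous L.
Proof.
pose C := \sum_j `|L (delta_mx 0 j)|.
have C0 : 0 <= C by apply: sumr_ge0.
have LC v : `|L v| <= d%:R * C * `|v|.
  have := @linear_sub_bound R d e L \0 C v; rewrite subr0; apply=> j.
  by rewrite subr0 /C (bigD1 j) //= lerDl sumr_ge0.
move=> v; apply/continuous_eps_delta => r r0; exists (r / (d%:R * C + 1)).
  by rewrite divr_gt0 // ltr_pwDr // mulr_ge0.
move=> y yv; rewrite -linearB; apply: le_lt_trans (LC _) _.
have D0 : 0 < d%:R * C + 1 by rewrite ltr_pwDr // mulr_ge0.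
move: yv; rewrite ltr_pdivlMr // => yv; apply: le_lt_trans yv.
by rewrite mulrC ler_wpM2l // lerDl.
Qed.

Lemma linear_row_bound d e (L : {linear 'rV[R]_d -> 'rV[R]_e}) :
  exists2 C, 0 < C & forall v, `|L v| <= C * `|v|.
Proof. exact/linear_lipschitz/linear_row_continuous. Qed.

Lemma mulmxr_continuous d e (A : 'M[R]_(d, e)) : continuous (fun v : 'rV[R]_d => v *m A).
Proof. exact: (@linear_row_continuous d e (mulmxr A)). Qed.

Lemma mulmxr_differentiable d e (A : 'M[R]_(d, e)) (x : 'rV[R]_d) :
  differentiable (fun v : 'rV[R]_d => v *m A) x.
Proof. by apply: (@linear_differentiable _ _ _ (mulmxr A)); exact: mulmxr_continuous. Qed.

Lemma mulmxr_diff d e (A : 'M[R]_(d, e)) (x v : 'rV[R]_d) :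
  'd (fun v : 'rV[R]_d => v *m A) x v = v *m A.
Proof.
have cA : continuous (mulmxr A : {linear 'rV[R]_d -> 'rV[R]_e}) by exact: mulmxr_continuous.
by rewrite (diff_lin x cA).
Qed.

End linear_maps.

Section class_C_closure.
Context {R : realType}.

Lemma class_C_sub d e k (U U' : set 'rV[R]_d) (f : 'rV[R]_d -> 'rV[R]_e) :
  U' `<=` U -> class_C k U f -> class_C k U' f.
Proof.
move=> sub; elim: k f => [|k IH] f /=; first by move=> h x /sub; exact: h.
by move=> [df h]; split=> [x /sub|v]; [exact: df|apply: IH].
Qed.

(** Needed because the derivative of a composite is known only on [U]; openness
    of [U] makes differentials depend only on the values on [U]. *)
Lemma class_C_ext d e k (U : set 'rV[R]_d) (f g : 'rV[R]_d -> 'rV[R]_e) :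
  open U -> (forall x, U x -> f x = g x) -> class_C k U f -> class_C k U g.
Proof.
move=> oU; elim: k f g => [|k IH] f g fg /=.
  move=> h x Ux; apply/continuous_eps_delta => r r0.
  have [s s0 hs] := (continuous_eps_delta _ _).1 (h x Ux) r r0.
  have [t t0 ht] := (nbhs_eps _ _).1 (open_nbhs_nbhs (conj oU Ux)).
  exists (Num.min s t); first by rewrite lt_min s0.
  by move=> y; rewrite lt_min => /andP[ys yt]; rewrite -!fg; [exact: hs| |exact: ht].
move=> [df h]; have dg x (Ux : U x) := eq_on_open_diff oU Ux fg (df x Ux).
split=> [x Ux|v]; first exact: (dg x Ux).1.
have E x : U x -> 'd f x v = 'd g x v 
  by move=> Ux; exact: (esym (congr1 (@^~ v) (dg x Ux).2)).
exact: (IH _ _ E (h v)).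
Qed.

Lemma class_C_mulmxr d e e' k (U : set 'rV[R]_d) (f : 'rV[R]_d -> 'rV[R]_e)
    (A : 'M[R]_(e, e')) :
  open U -> class_C k U f -> class_C k U (fun x => f x *m A).
Proof.
move=> oU; elim: k f => [|k IH] f /=.
  move=> h x Ux; apply: (@continuous_comp _ _ _ f (fun v : 'rV[R]_e => v *m A)).
    exact: h.
  exact: mulmxr_continuous.
move=> [df h]; split=> [x Ux|v].
  apply: (@differentiable_comp _ _ _ _ f (fun v : 'rV[R]_e => v *m A)); first exact: df.
  exact: mulmxr_differentiable.
apply: (class_C_ext oU _ (IH _ (h v))) => x Ux /=.
have := @diff_comp _ _ _ _ f (fun v : 'rV[R]_e => v *m A) x (df x Ux) (mulmxr_differentiable _ _).
by move=> /(congr1 (@^~ v)) h1; rewrite -(mulmxr_diff A (f x)); exact: esym.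
Qed.

Lemma class_C_comp_mulmxr d d' e k (U : set 'rV[R]_d) (f : 'rV[R]_d -> 'rV[R]_e)
    (B : 'M[R]_(d', d)) :
  open U -> class_C k U f ->
  class_C k [set y | U (y *m B)] (fun y => f (y *m B)).
Proof.
move=> oU; have oU' : open [set y : 'rV[R]_d' | U (y *m B)].
  by apply: (@open_comp _ _ (fun y : 'rV[R]_d' => y *m B)) => // ? _; exact: mulmxr_continuous.
elim: k f => [|k IH] f /=.
  move=> h x Ux; apply: (@continuous_comp _ _ _ (fun v : 'rV[R]_d' => v *m B) f).
    exact: mulmxr_continuous.
  exact: h.
move=> [df h]; split=> [x Ux|v].
  apply: (@differentiable_comp _ _ _ _ (fun v : 'rV[R]_d' => v *m B) f); last exact: df.
  exact: mulmxr_differentiable.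
apply: (class_C_ext oU' _ (IH _ (h (v *m B)))) => x Ux /=.
have := @diff_comp _ _ _ _ (fun v : 'rV[R]_d' => v *m B) f x (mulmxr_differentiable _ _) (df _ Ux).
by move=> /(congr1 (@^~ v)) h1; rewrite -(mulmxr_diff B x v); exact: esym.
Qed.

End class_C_closure.

(** * Linear frames adapted to a decomposition *)

Section frame.
Context {R : realType}.

Lemma vspace_rows d k (F : {vspace 'rV[R]_d}) : \dim F = k ->
  exists B : 'M[R]_(k, d), forall u, u \in F <-> exists a : 'rV_k, u = a *m B.
Proof.
move=> <-; exists (\matrix_i (vbasis F)`_i) => u.
have E (a : 'rV_(\dim F)) :
    a *m (\matrix_i (vbasis F)`_i) = \sum_i a 0 i *: (vbasis F)`_i.
  rewrite mulmx_sum_row; apply: eq_bigr => i _; congr (_ *: _).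
  by apply/rowP => j; rewrite !mxE.
split=> [uF|[a ->]].
  exists (\row_i coord (vbasis F) i u); rewrite E [LHS](coord_vbasis uF).
  by apply: eq_bigr => i _; rewrite mxE.
rewrite E; apply: memv_suml => i _; apply: memvZ; apply: vbasis_mem.
by rewrite mem_nth // size_tuple.
Qed.

Lemma adapted_frame d m n (F G : {vspace 'rV[R]_d}) :
  (m + n)%N = d -> \dim F = m -> \dim G = n -> (F + G)%VS = fullv ->
  exists (A : 'M[R]_(d, m + n)) (B : 'M[R]_(m + n, d)),
    [/\ A *m B = 1%:M, B *m A = 1%:M,
        forall u, u \in G <-> lsubmx (u *m A) = 0 &
        forall u, u \in F <-> rsubmx (u *m A) = 0].
Proof.
move=> dE; subst d => dF dG FG.
have [BF hF] := vspace_rows dF; have [BG hG] := vspace_rows dG.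
pose B := col_mx BF BG.
have span u : exists w : 'rV_(m + n), u = w *m B.
  have /memv_addP[f /hF[a ->] [g /hG[b ->] ->]] : u \in (F + G)%VS by rewrite FG memvf.
  by exists (row_mx a b); rewrite mul_row_col.
have /choice[w hw] (i : 'I_(m + n)) : exists w : 'rV_(m + n), delta_mx 0 i = w *m B by exact: span.
pose A := \matrix_i w i.
have AB : A *m B = 1%:M.
  by apply/row_matrixP => i; rewrite row_mul rowK -hw row1.
have BA := mulmx1C AB; exists A, B; split=> // u.
- split=> [/hG[b ->]|h].
    have -> : b *m BG = row_mx 0 b *m B by rewrite mul_row_col mul0mx add0r.
    by rewrite -mulmxA BA mulmx1 row_mxKl.
  apply/hG; exists (rsubmx (u *m A)).
  by rewrite -[LHS]mulmx1 -AB mulmxA -{1}[u *m A]hsubmxK h mul_row_col mul0mx add0r.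
- split=> [/hF[a ->]|h].
    have -> : a *m BF = row_mx a 0 *m B by rewrite mul_row_col mul0mx addr0.
    by rewrite -mulmxA BA mulmx1 row_mxKr.
  apply/hF; exists (lsubmx (u *m A)).
  by rewrite -[LHS]mulmx1 -AB mulmxA -{1}[u *m A]hsubmxK h mul_row_col mul0mx addr0.
Qed.

End frame.

(** * Cones of secants *)

Section cones.
Context {R : realType}.

(** The Whitney cone of a subset of a vector space at [p], in a form that avoids
    sequences. *)
Definition secant_cone d (S : set 'rV[R]_d) (p : 'rV[R]_d) : set 'rV[R]_d :=
  [set u | forall e, 0 < e -> exists y z c,
     [/\ S y /\ S z, 0 < c, `|y - p| < e, `|z - p| < e & `|c *: (z - y) - u| < e]].

Definition strict_diff_at d e (f L : 'rV[R]_d -> 'rV[R]_e) (p : 'rV[R]_d) :=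
  forall eps, 0 < eps -> exists2 r, 0 < r &
    forall y z, `|y - p| < r -> `|z - p| < r ->
      `|f z - f y - L (z - y)| <= eps * `|z - y|.

Lemma strict_diff_bound d e (f : 'rV[R]_d -> 'rV[R]_e) (L : {linear 'rV[R]_d -> 'rV[R]_e}) p :
  strict_diff_at f L p -> exists2 K, 0 < K & exists2 r, 0 < r &
    forall y z, `|y - p| < r -> `|z - p| < r -> `|f z - f y| <= K * `|z - y|.
Proof.
move=> hf; have [C C0 hC] := linear_row_bound L; have [r r0 hr] := hf 1 ltr01.
exists (C + 1); first by rewrite addr_gt0.
exists r => // y z yr zr; rewrite -[_ - f y](subrK (L (z - y))).
apply: le_trans (ler_normD _ _) _; have := hr y z yr zr; have := hC (z - y).
by rewrite mulrDl; lra.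
Qed.

(** Along secants [z - y] whose rescalings by [c] converge, [c * |z - y|] stays
    bounded, so the error of strict differentiability is negligible after
    rescaling. *)
Lemma secant_cone_image d e (S : set 'rV[R]_d) (S' : set 'rV[R]_e) f
    (L : {linear 'rV[R]_d -> 'rV[R]_e}) p r u :
  0 < r -> (forall y, S y -> `|y - p| < r -> S' (f y)) -> strict_diff_at f L p ->
  secant_cone S p u -> secant_cone S' (f p) (L u).
Proof.
move=> r0 hS hf hu e' e0.
have [C C0 hC] := linear_row_bound L.
have [K K0 [r1 r10 hK]] := strict_diff_bound hf.
pose U := `|u| + 1; have U0 : 0 < U by rewrite ltr_pwDr.
have eps0 : 0 < e' / 2 / U by rewrite !divr_gt0.
have [r2 r20 hr2] := hf _ eps0.
pose r3 := Num.min (Num.min 1 (Num.min r (Num.min r1 r2))) (Num.min (e' / K) (e' / 2 / C)).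
have r30 : 0 < r3 by rewrite !lt_min ltr01 r0 r10 r20 !divr_gt0.
have [y [z [c [[Sy Sz] c0]]]] := hu r3 r30; rewrite !lt_min.
move=> /andP[/and4P[_ yr yr1 yr2] /andP[yK _]] /andP[/and4P[_ zr zr1 zr2] /andP[zK _]].
move=> /andP[/and4P[cu1 _ _ _] /andP[_ cuC]].
have p1 : `|p - p| < r1 by rewrite subrr normr0.
have lip a : `|a - p| < r1 -> `|a - p| < e' / K -> `|f a - f p| < e'.
  move=> ar aK; apply: le_lt_trans (hK p a p1 ar) _.
  by rewrite mulrC -ltr_pdivlMr.
exists (f y), (f z), c; split=> //; try by apply: lip.
  by split; apply: hS.
have -> : c *: (f z - f y) - L u =
    c *: (f z - f y - L (z - y)) + L (c *: (z - y) - u).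
  by rewrite [c *: (_ - _ - _)]scalerBr [L (_ - u)]linearB [L (c *: _)]linearZ /= addrA subrK.
apply: le_lt_trans (ler_normD _ _) _; rewrite normrZ (gtr0_norm c0).
have h1 : `|L (c *: (z - y) - u)| < e' / 2.
  by apply: le_lt_trans (hC _) _; rewrite mulrC -ltr_pdivlMr.
have cz : c * `|z - y| <= U.
  rewrite -{1}(gtr0_norm c0) -normrZ -[c *: _](subrK u).
  by apply: le_trans (ler_normD _ _) _; rewrite addrC lerD2l ltW.
have h2 : c * `|f z - f y - L (z - y)| <= e' / 2.
  apply: le_trans (_ : _ <= c * (e' / 2 / U * `|z - y|)) _; first by rewrite ler_pM2l // hr2.
  by rewrite mulrCA -[leRHS](divfK (lt0r_neq0 U0)) ler_pM2l.
by have := ltr_leD h1 h2; rewrite -splitr addrC.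
Qed.

Lemma secant_cone_cluster d (S : set 'rV[R]_d) p (w : nat -> 'rV[R]_d) r :
  (forall k, `|w k| <= r) ->
  (forall k, exists y z c, [/\ S y /\ S z, 0 < c, `|y - p| < k.+1%:R^-1,
       `|z - p| < k.+1%:R^-1 & w k = c *: (z - y)]) ->
  exists2 u, secant_cone S p u &
    forall e N, 0 < e -> exists2 k, (N <= k)%N & `|w k - u| < e.
Proof.
move=> wr hw; have [u _ hu] := bounded_cluster wr; exists u => // e e0.
have [N hN] := inv_nat_lt e0; have [k Nk ku] := hu e N e0.
have [y [z [c [Syz c0 yk zk wE]]]] := hw k.
exists y, z, c; split=> //; [exact: lt_trans yk (hN k Nk)|exact: lt_trans zk (hN k Nk)|].
by rewrite -wE.
Qed.

Section horizontal_vertical.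
Context (m n : nat).
Implicit Types (S : set 'rV[R]_(m + n)) (q : 'rV[R]_(m + n)).

(** Normalizing secants by their vertical part keeps them bounded when the
    inverse slopes are bounded; a cluster point is a vector of the cone that is
    not horizontal, and whose horizontal part is controlled by the inverse slopes
    [a k]. *)
Lemma steep_secants S q (a : nat -> R) H : (forall k, a k <= H) ->
  (forall k, exists y z, [/\ S y /\ S z, `|y - q| < k.+1%:R^-1, `|z - q| < k.+1%:R^-1,
     0 < `|rsubmx (z - y)| & `|lsubmx (z - y)| <= a k * `|rsubmx (z - y)|]) ->
  exists2 u, secant_cone S q u & `|rsubmx u| = 1 /\
    forall e N, 0 < e -> exists2 k, (N <= k)%N & `|lsubmx u| < a k + e.
Proof.
move=> aH /choice[y /choice[z hyz]].
pose c k := `|rsubmx (z k - y k)|^-1.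
have c0 k : 0 < c k by have [_ _ _ h _] := hyz k; rewrite invr_gt0.
pose w k := c k *: (z k - y k).
have wr k : `|rsubmx (w k)| = 1.
  have [_ _ _ h _] := hyz k.
  by rewrite /w linearZ /= normrZ gtr0_norm // mulVf // gt_eqF.
have wl k : `|lsubmx (w k)| <= a k.
  have [_ _ _ h hl] := hyz k.
  by rewrite /w linearZ /= normrZ gtr0_norm // mulrC ler_pdivrMr.
have wb k : `|w k| <= Num.max H 1.
  by apply: norm_split_le; rewrite le_max ?wr ?lexx ?orbT // (le_trans (wl k)).
have [|u Su clu] := @secant_cone_cluster _ S q w _ wb.
  by move=> k; have [? ? ? _ _] := hyz k; exists (y k), (z k), (c k).
exists u => //; split.
  apply/eqP; rewrite eq_le; apply/andP; split.
    apply/ler_addgt0Pr => e e0; have [k _ ku] := clu e 0%N e0.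
    have := norm_rsubmx_le (w k - u); rewrite raddfB /=.
    have := ler_distD (rsubmx (w k)) (rsubmx u) 0; rewrite !subr0 wr (distrC (rsubmx u)).
    by lra.
  apply/ler_addgt0Pr => e e0; have [k _ ku] := clu e 0%N e0.
  have := norm_rsubmx_le (w k - u); rewrite raddfB /=.
  have := ler_distD (rsubmx u) (rsubmx (w k)) 0; rewrite !subr0 wr.
  by lra.
move=> e N e0; have [k Nk ku] := clu e N e0; exists k => //.
have := norm_lsubmx_le (w k - u); rewrite raddfB /=.
have := ler_distD (lsubmx (w k)) (lsubmx u) 0; rewrite !subr0 (distrC (lsubmx u)).
by have := wl k; lra.
Qed.

(** Secants of unbounded slope would produce a nonzero vertical vector of the
    cone. *)
Lemma secant_cone_lipschitz S q :
  (forall u, secant_cone S q u -> lsubmx u = 0 -> u = 0) ->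
  exists2 K, 0 < K & exists2 r, 0 < r & forall y z, S y -> S z ->
    `|y - q| < r -> `|z - q| < r -> `|rsubmx (z - y)| <= K * `|lsubmx (z - y)|.
Proof.
move=> hC; apply: contrapT => no.
have [||u Su [ru lu]] := @steep_secants S q (fun k => k.+1%:R^-1) 1.
- by move=> k; rewrite invf_le1 ?ler1n ?ltr0n.
- move=> k; apply: contrapT => nk; apply: no; exists k.+1%:R; first by rewrite ltr0n.
  exists k.+1%:R^-1; first by rewrite invr_gt0 ltr0n.
  move=> y z Sy Sz yk zk; rewrite leNgt; apply/negP => lt; apply: nk.
  exists y, z; split=> //; first by apply: le_lt_trans lt; rewrite mulr_ge0.
  by rewrite ler_pdivlMl ?ltr0n // ltW.
have lu0 : lsubmx u = 0.
  apply/eqP; rewrite -normr_eq0 eq_le normr_ge0 andbT; apply/ler_addgt0Pr => e e0.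
  have e20 : 0 < e / 2 by rewrite divr_gt0.
  have [N hN] := inv_nat_lt e20; have [k Nk] := lu _ N e20; have := hN k Nk.
  by set b := _^-1; lra.
by move: ru; rewrite (hC u Su lu0) raddf0 normr0 => /eqP; rewrite eq_sym oner_eq0.
Qed.

(** Secants of slope larger than [e] arbitrarily close to [q] would produce a
    vector of the cone that is not horizontal. *)
Lemma secant_cone_flat S q :
  (forall u, secant_cone S q u -> rsubmx u = 0) ->
  forall e, 0 < e -> exists2 r, 0 < r & forall y z, S y -> S z ->
    `|y - q| < r -> `|z - q| < r -> `|rsubmx (z - y)| <= e * `|lsubmx (z - y)|.
Proof.
move=> hC e e0; apply: contrapT => no.
have [||u Su [ru _]] := @steep_secants S q (fun k => e^-1) e^-1; first by [].
  move=> k; apply: contrapT => nk; apply: no.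
  exists k.+1%:R^-1; first by rewrite invr_gt0 ltr0n.
  move=> y z Sy Sz yk zk; rewrite leNgt; apply/negP => lt; apply: nk.
  exists y, z; split=> //; first by apply: le_lt_trans lt; rewrite mulr_ge0 // ltW.
  by rewrite ler_pdivlMl // ltW.
by move: ru; rewrite (hC u Su) normr0 => /eqP; rewrite eq_sym oner_eq0.
Qed.

Variables (U : set 'rV[R]_m) (f : 'rV[R]_m -> 'rV[R]_n) (a0 : 'rV[R]_m).
Let graph := [set row_mx a (f a) | a in U].
Let q0 := row_mx a0 (f a0).

Lemma secant_cone_graphP w e : secant_cone graph q0 w -> 0 < e ->
  exists a b c, [/\ U a /\ U b, 0 < c, `|a - a0| < e /\ `|b - a0| < e,
     `|c *: (b - a) - lsubmx w| < e & `|c *: (f b - f a) - rsubmx w| < e].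
Proof.
move=> hw e0; have [_ [_ [c [[[a Ua <-] [b Ub <-]] c0 ha hb hc]]]] := hw e e0.
have sub (v : 'rV[R]_(m + n)) : `|v| < e -> `|lsubmx v| < e /\ `|rsubmx v| < e.
  by move=> ve; split; apply: le_lt_trans ve; [exact: norm_lsubmx_le|exact: norm_rsubmx_le].
have [{}ha _] := sub _ ha; have [{}hb _] := sub _ hb; have [h1 h2] := sub _ hc.
exists a, b, c; split=> //.
- by move: ha hb; rewrite !raddfB /= !row_mxKl.
- by move: h1; rewrite raddfB /= linearZ /= raddfB /= !row_mxKl.
- by move: h2; rewrite raddfB /= linearZ /= raddfB /= !row_mxKr.
Qed.

Lemma lipschitz_graph_cone w : lipschitz_at f a0 ->
  secant_cone graph q0 w -> lsubmx w = 0 -> w = 0.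
Proof.
move=> [C [V nV lipV]] hw lw; rewrite -[w]hsubmxK lw.
suff -> : rsubmx w = 0 by rewrite row_mx0.
have [r r0 hr] := (nbhs_eps _ _).1 nV.
pose K := `|C| + 1; have K0 : 0 < K by rewrite ltr_pwDr.
apply/eqP; rewrite -normr_eq0 eq_le normr_ge0 andbT; apply/ler_addgt0Pr => e e0.
pose e1 := Num.min r (Num.min (e / 2) (e / 2 / K)).
have e10 : 0 < e1 by rewrite !lt_min r0 !divr_gt0.
have [a [b [c [_ c0]]]] := secant_cone_graphP hw e10.
rewrite lw subr0 normrZ gtr0_norm // !lt_min.
move=> [/and3P[ar _ _] /and3P[br _ _]] /and3P[_ _ lK] /and3P[_ h _].
have := lipV (b, a) (conj (hr _ br) (hr _ ar)) => /= lip.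
have lip' : c * `|f b - f a| <= e / 2.
  apply: le_trans (_ : _ <= c * (K * `|b - a|)) _.
    rewrite ler_pM2l //; apply: le_trans lip _; rewrite ler_wpM2r //.
    by rewrite /K (le_trans (ler_norm C)) // lerDl.
  by rewrite mulrCA mulrC -ler_pdivlMr // ltW.
have := ler_distD (c *: (f b - f a)) (rsubmx w) 0; rewrite !subr0 normrZ gtr0_norm //.
by rewrite (distrC (rsubmx w)); lra.
Qed.

Lemma strict_graph_cone (L : {linear 'rV[R]_m -> 'rV[R]_n}) w : strict_diff_at f L a0 ->
  secant_cone graph q0 w -> rsubmx w = L (lsubmx w).
Proof.
move=> hf hw; have [C C0 hC] := linear_row_bound L.
apply/eqP; rewrite -subr_eq0 -normr_eq0 eq_le normr_ge0 andbT; apply/ler_addgt0Pr => e e0.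
pose D := `|lsubmx w| + 1; have D0 : 0 < D by rewrite ltr_pwDr.
have eps0 : 0 < e / 3 / D by rewrite !divr_gt0.
have [r r0 hr] := hf _ eps0.
pose e1 := Num.min (Num.min r 1) (Num.min (e / 3) (e / 3 / C)).
have e10 : 0 < e1 by rewrite !lt_min r0 ltr01 !divr_gt0.
have [a [b [c [_ c0]]]] := secant_cone_graphP hw e10; rewrite !lt_min.
move=> [/andP[/andP[ar _] _] /andP[/andP[br _] _]].
move=> /andP[/andP[_ l1] /andP[_ lC]] /andP[_ /andP[h3 _]].
have cz : c * `|b - a| <= D.
  rewrite -{1}(gtr0_norm c0) -normrZ -[c *: _](subrK (lsubmx w)).
  by apply: le_trans (ler_normD _ _) _; rewrite addrC lerD2l ltW.
have h2 : c * `|f b - f a - L (b - a)| <= e / 3.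
  apply: le_trans (_ : _ <= c * (e / 3 / D * `|b - a|)) _; first by rewrite ler_pM2l // hr.
  by rewrite mulrCA -[leRHS](divfK (lt0r_neq0 D0)) ler_pM2l.
have h1 : `|L (c *: (b - a) - lsubmx w)| < e / 3.
  by apply: le_lt_trans (hC _) _; rewrite mulrC -ltr_pdivlMr.
have -> : rsubmx w - L (lsubmx w) = (rsubmx w - c *: (f b - f a)) +
   c *: (f b - f a - L (b - a)) + L (c *: (b - a) - lsubmx w).
  by rewrite [c *: (_ - _ - _)]scalerBr [L (_ - lsubmx w)]linearB [L (c *: _)]linearZ /= !addrA !subrK.
move: h3; rewrite distrC => h3.
apply: le_trans (ler_normD _ _) _; have := ler_normD (rsubmx w - c *: (f b - f a)) (c *: (f b - f a - L (b - a))).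
by rewrite [`|c *: (_ - _ - _)|]normrZ (gtr0_norm c0) add0r; lra.
Qed.

(** The secants from the base point in the direction [v] suffice. *)
Lemma graph_cone_strict (L : {linear 'rV[R]_m -> 'rV[R]_n}) v : open U -> U a0 ->
  strict_diff_at f L a0 -> secant_cone graph q0 (row_mx v (L v)).
Proof.
move=> oU Ua0 hf e e0.
have [K K0 [r1 r10 hK]] := strict_diff_bound hf.
have [r r0 hr] := (nbhs_eps _ _).1 (open_nbhs_nbhs (conj oU Ua0)).
pose D := `|v| + 1; have D0 : 0 < D by rewrite ltr_pwDr.
have eps0 : 0 < e / 2 / D by rewrite !divr_gt0.
have [r2 r20 hr2] := hf _ eps0.
pose r3 := Num.min (Num.min r (Num.min r1 r2)) (Num.min (e / 2) (e / 2 / K)).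
have r30 : 0 < r3 by rewrite !lt_min r0 r10 r20 !divr_gt0.
pose t := r3 / 2 / D; have t0 : 0 < t by rewrite !divr_gt0.
pose a := a0 + t *: v.
have aE : a - a0 = t *: v by rewrite /a addrC addKr.
have tv : `|a - a0| < r3.
  rewrite aE normrZ gtr0_norm // /t mulrAC ltr_pdivrMr //.
  apply: le_lt_trans (_ : _ <= r3 / 2 * D) _; first by rewrite ler_pM2l ?divr_gt0 // /D lerDl.
  by rewrite ltr_pM2r //; lra.
have z0 x : 0 < x -> `|a0 - a0| < x by rewrite subrr normr0.
move: (tv); rewrite !lt_min => /andP[/and3P[ar ar1 ar2] /andP[ae aK]].
exists q0, (row_mx a (f a)), t^-1; split=> //.
- by split; [exists a0|exists a => //; exact: hr].
- by rewrite invr_gt0.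
- by rewrite subrr normr0.
- have h : `|row_mx a (f a) - q0| <= e / 2.
    rewrite /q0 opp_row_mx add_row_mx; apply: norm_split_le; rewrite ?row_mxKl ?row_mxKr ?ltW //.
    by apply: le_lt_trans (hK _ _ (z0 _ r10) ar1) _; rewrite mulrC -ltr_pdivlMr.
  by apply: le_lt_trans h _; lra.
- have h : `|t^-1 *: (row_mx a (f a) - q0) - row_mx v (L v)| <= e / 2.
    rewrite /q0 opp_row_mx add_row_mx scale_row_mx opp_row_mx add_row_mx aE scalerA mulVf ?gt_eqF //.
    rewrite scale1r subrr; apply: norm_split_le; rewrite ?row_mxKl ?row_mxKr ?normr0.
      by rewrite divr_ge0 // ltW.
    have -> : t^-1 *: (f a - f a0) - L v = t^-1 *: (f a - f a0 - L (a - a0)).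
      by rewrite aE linearZ /= [RHS]scalerBr scalerA mulVf ?gt_eqF // scale1r.
    rewrite normrZ gtr0_norm ?invr_gt0 // ler_pdivrMl //.
    apply: le_trans (hr2 _ _ (z0 _ r20) ar2) _.
    rewrite aE normrZ gtr0_norm // mulrCA ler_pM2l //.
    by rewrite mulrAC ler_pdivrMr // ler_pM2l ?divr_gt0 // /D lerDl.
  by apply: le_lt_trans h _; lra.
Qed.

End horizontal_vertical.
End cones.

(** * Charts and the Whitney cone *)

Lemma open_preimage_on (T T' : topologicalType) (g : T -> T') (D : set T) (W : set T') :
  open D -> (forall v, D v -> {for v, continuous g}) -> open W ->
  open (D `&` [set v | W (g v)]).
Proof.
move=> oD cg oW; rewrite openE => v [Dv Wv].
have nD : nbhs v D by exact: open_nbhs_nbhs.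
have nW : nbhs v [set v | W (g v)] by apply: (cg v Dv); exact: open_nbhs_nbhs.
exact: filterI nD nW.
Qed.

Section charts.
Context {R : realType} {T : topologicalType}.

Lemma chart_image_open d (c : chart R T d) (W : set T) : open W ->
  open (c @` (chart_dom c `&` W)).
Proof.
move=> oW; rewrite (_ : _ @` _ = c @` chart_dom c `&` [set v | W (chart_inv c v)]).
  by apply: open_preimage_on => //; [exact: chart_img_open|exact: chart_inv_continuous].
apply/seteqP; split=> [_ [t [ct Wt] <-]|_ [[t ct <-]]] /=.
  by split; [exists t|rewrite chart_mapK].
by rewrite chart_mapK // => Wt; exists t.
Qed.

Lemma transition_chart d e (c : chart R T d) (c' : chart R T e) t : chart_dom c t ->
  transition c c' (c t) = c' t.
Proof. by move=> ct; rewrite /transition /= chart_mapK. Qed.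

Lemma transition_strict d e (c : chart R T d) (c' : chart R T e) x :
  compatible c c' -> chart_dom c x -> chart_dom c' x ->
  differentiable (transition c c') (c x) /\
  strict_diff_at (transition c c') ('d (transition c c') (c x)) (c x).
Proof.
move=> [/(_ 1%N) sm _] cx c'x.
have oU := chart_image_open (c := c) (chart_dom_open c').
have Ux : (c @` (chart_dom c `&` chart_dom c')) (c x) by exists x.
split; first exact: sm.1.
exact: (C1_strictly_differentiable oU sm Ux).
Qed.

Lemma secant_cone_chart d e (c : chart R T d) (c' : chart R T e) (M : set T) x u :
  compatible c c' -> chart_dom c x -> chart_dom c' x ->
  secant_cone (c @` (M `&` chart_dom c)) (c x) u ->
  secant_cone (c' @` (M `&` chart_dom c')) (c' x) ('d (transition c c') (c x) u).
Proof.
move=> cc cx c'x; rewrite -[in X in _ -> X](transition_chart c' cx).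
have oU := chart_image_open (c := c) (chart_dom_open c').
have Ux : (c @` (chart_dom c `&` chart_dom c')) (c x) by exists x.
have [r r0 hr] := (nbhs_eps _ _).1 (open_nbhs_nbhs (conj oU Ux)).
apply: (secant_cone_image r0); last exact: (transition_strict cc cx c'x).2.
move=> _ [t [Mt ct] <-] /hr[t' [ct' c't'] ett'].
have ett : t' = t by rewrite -(chart_mapK ct) -ett' chart_mapK.
by rewrite transition_chart //; exists t => //; split=> //; rewrite -ett.
Qed.

Lemma compatible_sym d e (c : chart R T d) (c' : chart R T e) :
  compatible c c' -> compatible c' c.
Proof. by move=> [s1 s2]; rewrite /compatible setIC; split. Qed.

(** Chain rule for two inverse transition maps, whose composite is the identity
    only on an open set. *)
Lemma transitionK d e (c : chart R T d) (c' : chart R T e) x u :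
  compatible c c' -> chart_dom c x -> chart_dom c' x ->
  'd (transition c' c) (c' x) ('d (transition c c') (c x) u) = u.
Proof.
move=> cc cx c'x; have cc' : compatible c' c by exact: compatible_sym.
have [d1 _] := transition_strict cc cx c'x.
have [d2 _] := transition_strict cc' c'x cx.
have oU := chart_image_open (c := c) (chart_dom_open c').
have Ux : (c @` (chart_dom c `&` chart_dom c')) (c x) by exists x.
have eU y : (c @` (chart_dom c `&` chart_dom c')) y ->
    id y = (transition c' c \o transition c c') y.
  by move=> [t [ct c't] <-] /=; rewrite !transition_chart.
have idd : differentiable (id : 'rV[R]_d -> 'rV[R]_d) (c x) by [].
have [_ e1] := eq_on_open_diff oU Ux eU idd.
have d2' : differentiable (transition c' c) (transition c c' (c x)).
  by rewrite transition_chart.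
have e2 := diff_comp d1 d2'.
have e3 : 'd (id : 'rV[R]_d -> 'rV[R]_d) (c x) = id :> ('rV[R]_d -> 'rV[R]_d).
  exact: diff_val.
have e4 := etrans (esym e2) (etrans e1 e3).
have := congr1 (@^~ u) e4.
by rewrite /= transition_chart.
Qed.

End charts.

Section linear_change.
Context {R : realType} {T : topologicalType} {d e : nat} (c : chart R T d).
Variables (A : 'M[R]_(d, e)) (B : 'M[R]_(e, d)) (W : set 'rV[R]_e).
Hypotheses (AB : A *m B = 1%:M) (BA : B *m A = 1%:M) (oW : open W).

Let dom := chart_dom c `&` [set t | W (c t *m A)].
Let map t := c t *m A.
Let inv v := chart_inv c (v *m B).

Lemma linear_chart_map_continuous t : chart_dom c t -> {for t, continuous map}.
Proof.
move=> ct; apply: (@continuous_comp _ _ _ c (fun v : 'rV[R]_d => v *m A)).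
  exact: chart_map_continuous.
exact: mulmxr_continuous.
Qed.

Lemma linear_chart_dom_open : open dom.
Proof.
have cm t : chart_dom c t -> {for t, continuous map} := @linear_chart_map_continuous t.
exact: (open_preimage_on (chart_dom_open c) cm oW).
Qed.

Lemma linear_chart_imgE :
  map @` dom = [set v | (c @` chart_dom c) (v *m B)] `&` W.
Proof.
apply/seteqP; split=> [_ [t [ct Wt] <-]|v [[t ct e1] Wv]] /=.
  by split=> //; exists t => //; rewrite /map -mulmxA AB mulmx1.
have e2 : c t *m A = v by rewrite e1 -mulmxA BA mulmx1.
by exists t => //; split=> //=; rewrite e2.
Qed.

Lemma linear_chart_img_open : open (map @` dom).
Proof.
rewrite linear_chart_imgE; apply: openI => //.
apply: (@open_comp _ _ (fun v : 'rV[R]_e => v *m B)); last exact: chart_img_open.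
by move=> v _; exact: mulmxr_continuous.
Qed.

Lemma linear_chart_mapK t : dom t -> inv (map t) = t.
Proof. by move=> [ct _]; rewrite /inv /map -mulmxA AB mulmx1 chart_mapK. Qed.

Lemma linear_chart_map_continuous_dom t : dom t -> {for t, continuous map}.
Proof. by case=> ct _; exact: linear_chart_map_continuous. Qed.

Lemma linear_chart_inv_continuous v : (map @` dom) v -> {for v, continuous inv}.
Proof.
rewrite linear_chart_imgE => -[cv _].
apply: (@continuous_comp _ _ _ (fun v : 'rV[R]_e => v *m B) (chart_inv c)).
  exact: mulmxr_continuous.
exact: chart_inv_continuous.
Qed.

Definition linear_chart : chart R T e :=
  Chart linear_chart_dom_open linear_chart_img_open linear_chart_mapK linear_chart_map_continuous_dom
    linear_chart_inv_continuous.

Lemma linear_chart_compatible k (c' : chart R T k) :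
  compatible c c' -> compatible linear_chart c'.
Proof.
move=> [s1 s2]; split=> j.
- apply: (class_C_sub _ (class_C_comp_mulmxr B _ (s1 j))).
    move=> _ [t [[ct _] c't] <-] /=; exists t => //.
    by rewrite /map -mulmxA AB mulmx1.
  exact: chart_image_open (chart_dom_open _).
- apply: (class_C_sub _ (class_C_mulmxr A _ (s2 j))).
    by move=> _ [t [[ct _] c't] <-] /=; exists t.
  rewrite setIC; exact: chart_image_open (chart_dom_open _).
Qed.

Lemma linear_chart_diff x u : chart_dom c x ->
  'd (transition c linear_chart) (c x) u = u *m A.
Proof.
move=> cx; have Ux : (c @` chart_dom c) (c x) by exists x.
have eU y : (c @` chart_dom c) y -> y *m A = transition c linear_chart y.
  by move=> [t ct <-]; rewrite transition_chart.
have oI : open (c @` chart_dom c) by exact: chart_img_open.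
have [_ e1] := eq_on_open_diff oI Ux eU (mulmxr_differentiable A (c x)).
exact: etrans (congr1 (@^~ u) e1) (mulmxr_diff _ _ _).
Qed.

End linear_change.

Section whitney.
Context {R : realType} (P : manifold R) (M : set P) (x : P).
Let c0 := chart_at x.
Let c0x : chart_dom c0 x := chart_at_dom x.

(** Sequences are extracted from neighbourhoods of radius [1 / k.+1]; they converge
    in the manifold because the inverse of the chart is continuous. *)
Lemma whitney_coneE :
  whitney_cone x M M = secant_cone (c0 @` (M `&` chart_dom c0)) (c0 x).
Proof.
have nD : nbhs x (chart_dom c0).
  by apply: open_nbhs_nbhs; split; [exact: chart_dom_open|].
apply/seteqP; split=> u.
  move=> [a [b [c [hab ax bx cu]]]] e e0.
  have nx : nbhs x (chart_dom c0 `&` [set y | `|c0 x - c0 y| < e]).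
    apply: filterI nD _; move/cvgrPdist_lt: (chart_map_continuous c0x); exact.
  move/cvgrPdist_lt: cu => /(_ e e0) ce.
  have near_dom (a' : nat -> P) : a' k @[k --> \oo] --> x ->
      \forall k \near \oo, chart_dom c0 (a' k) /\ `|c0 x - c0 (a' k)| < e.
    by move=> /(_ _ nx).
  have [k [[[ak1 ak2] [bk1 bk2]] ck]] :=
    filter_ex (filterI (filterI (near_dom a ax) (near_dom b bx)) ce).
  move: ak2 bk2 ck => /= ak2 bk2 ck.
  have [Ma Mb c_gt0] := hab k.
  exists (c0 (a k)), (c0 (b k)), (c k); split=> //; try by rewrite distrC.
  by split; [exists (a k)|exists (b k)].
move=> hu.
have /choice[a /choice[b /choice[c habc]]] (k : nat) : exists a b c,
   [/\ [/\ M a, chart_dom c0 a & `|c0 a - c0 x| < k.+1%:R^-1],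
       [/\ M b, chart_dom c0 b & `|c0 b - c0 x| < k.+1%:R^-1], 0 < c &
       `|c *: (c0 b - c0 a) - u| < k.+1%:R^-1].
  have [|_ [_ [c [[[a [Ma ca] <-] [b [Mb cb] <-]] c_gt0 ha hb hc]]]] := hu k.+1%:R^-1.
    by rewrite invr_gt0 ltr0n.
  by exists a, b, c.
have lim (a' : nat -> P) : (forall k, chart_dom c0 (a' k)) ->
    (forall k, `|c0 (a' k) - c0 x| < k.+1%:R^-1) -> a' k @[k --> \oo] --> x.
  move=> ca' ha'; have E : a' = chart_inv c0 \o (c0 \o a').
    by apply/funext => k /=; rewrite chart_mapK.
  have Ix : (c0 @` chart_dom c0) (c0 x) by exists x.
  have cl : (c0 \o a') k @[k --> \oo] --> c0 x.
    apply/cvgrPdist_lt => e e0; have [N hN] := inv_nat_lt e0.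
    by exists N => // k /= Nk; rewrite distrC; exact: lt_trans (ha' k) (hN k Nk).
  have := cvg_comp _ _ cl (chart_inv_continuous Ix).
  by rewrite chart_mapK // => h; rewrite E; exact: h.
exists a, b, c; split.
- by move=> k; have [[? _ _] [? _ _] ? _] := habc k.
- by apply: lim => k; have [[]] := habc k.
- by apply: lim => k; have [_ []] := habc k.
- apply/cvgrPdist_lt => e e0; have [N hN] := inv_nat_lt e0.
  exists N => // k /= Nk; rewrite distrC; have [_ _ _ h] := habc k.
  exact: lt_trans h (hN k Nk).
Qed.

Section smooth.
Context (d : nat) (phi : chart R P d).
Hypotheses (sphi : smooth_chart phi) (phix : chart_dom phi x).

Let cphi : compatible c0 phi.
Proof. exact/compatible_sym/sphi/chart_at_atlas. Qed.

Let S := 'd (transition phi c0) (phi x).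

Lemma tangent_mapK u : S (tangent_map x phi u) = u.
Proof. exact: transitionK cphi c0x phix. Qed.

Lemma tangent_mapKV v : tangent_map x phi (S v) = v.
Proof. exact: transitionK (compatible_sym cphi) phix c0x. Qed.

(** Independence of the Whitney cone from the chart. *)
Lemma tangent_map_cone :
  tangent_map x phi @` whitney_cone x M M =
  secant_cone (phi @` (M `&` chart_dom phi)) (phi x).
Proof.
rewrite whitney_coneE; apply/seteqP; split=> [_ [u Cu <-]|v Cv].
  exact: secant_cone_chart cphi c0x phix Cu.
exists (S v); last exact: tangent_mapKV.
exact: secant_cone_chart (compatible_sym cphi) phix c0x Cv.
Qed.

End smooth.
End whitney.

(** * Construction of a local graph *)

Section graph_construction.
Context {R : realType} (P : manifold R) (M : set P) (x : P) (m n : nat).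
Let c0 := chart_at x.
Let d := dim_at x.
Variables (A : 'M[R]_(d, m + n)) (B : 'M[R]_(m + n, d)) (K r : R).
Hypotheses (AB : A *m B = 1%:M) (BA : B *m A = 1%:M) (r0 : 0 < r).
Hypothesis Mx : M x.
Let phi0 t := c0 t *m A.
Let q := phi0 x.
Let S := phi0 @` (M `&` chart_dom c0).
Hypothesis lipS : forall y z, S y -> S z -> `|y - q| < r -> `|z - q| < r ->
  `|rsubmx (z - y)| <= K * `|lsubmx (z - y)|.
Variable c : chart R P (m + n).
Hypotheses (cx : chart_dom c x)
  (flat : c @` (M `&` chart_dom c) = c @` chart_dom c `&` [set v | rsubmx v = 0]).

Let c0x : chart_dom c0 x := chart_at_dom x.

Lemma framed_chart_inj t t' : chart_dom c0 t -> chart_dom c0 t' -> phi0 t = phi0 t' -> t = t'.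
Proof.
move=> ct ct' /(congr1 (mulmx^~ B)); rewrite /phi0 -!mulmxA AB !mulmx1 => e.
by rewrite -(chart_mapK ct) e chart_mapK.
Qed.

(** The bound on slopes makes the horizontal projection injective on M near x. *)
Lemma framed_chart_eq_of_lsubmx t t' : M t -> chart_dom c0 t -> M t' -> chart_dom c0 t' ->
  `|phi0 t - q| < r -> `|phi0 t' - q| < r -> lsubmx (phi0 t) = lsubmx (phi0 t') ->
  phi0 t = phi0 t'.
Proof.
move=> Mt ct Mt' ct' tr tr' e; have St : S (phi0 t) by exists t.
have St' : S (phi0 t') by exists t'.
have := lipS St St' tr tr'; rewrite !raddfB /= e subrr normr0 mulr0 normr_le0 subr_eq0.
by move=> /eqP e'; rewrite -[phi0 t]hsubmxK e -e' hsubmxK.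
Qed.

(** A flat parametrization of M followed by the horizontal projection is a
    continuous injection between spaces of the same dimension [m], so invariance
    of domain applies. *)
Lemma projection_open : exists2 e, 0 < e & forall a, `|a - lsubmx q| < e ->
  exists t, [/\ M t, chart_dom c0 t, `|phi0 t - q| < r & lsubmx (phi0 t) = a].
Proof.
have [_ cr] : (c @` chart_dom c `&` [set v | rsubmx v = 0]) (c x).
  by rewrite -flat; exists x.
pose s0 := lsubmx (c x).
have s0E : row_mx s0 0 = c x by rewrite -cr hsubmxK.
pose emb (s : 'rV[R]_m) : 'rV[R]_(m + n) := row_mx s 0.
have embB s s' : emb s - emb s' = emb (s - s').
  by rewrite /emb opp_row_mx add_row_mx subr0.
have emb_norm s : `|emb s| <= `|s|.
  by apply: norm_split_le; rewrite /emb ?row_mxKl ?row_mxKr ?normr0.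
have emb_cont s : {for s, continuous emb}.
  apply/continuous_eps_delta => e e0; exists e => // s' ss'.
  by rewrite embB; apply: le_lt_trans (emb_norm _) ss'.
(* [gam] parametrizes M near x by a neighbourhood of [s0] in R^m *)
pose gam s := chart_inv c (emb s).
have oI : open (c @` chart_dom c) by exact: chart_img_open.
have gam_cont s : (c @` chart_dom c) (emb s) -> {for s, continuous gam}.
  by move=> Is; apply: continuous_comp (emb_cont s) _; exact: chart_inv_continuous.
have Is0 : (c @` chart_dom c) (emb s0) by exists x.
have gam0 : gam s0 = x by rewrite /gam /emb s0E chart_mapK.
have [r1 r10 hr1] : exists2 r1, 0 < r1 & forall s, `|s - s0| < r1 ->
    (c @` chart_dom c) (emb s).
  have [r1 r10 hr1] := (nbhs_eps _ _).1 (open_nbhs_nbhs (conj oI Is0)).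
  exists r1 => // s ss0; apply: hr1; rewrite embB.
  exact: le_lt_trans (emb_norm _) ss0.
have [r2 r20 hr2] : exists2 r2, 0 < r2 & forall s, `|s - s0| < r2 ->
    chart_dom c0 (gam s) /\ `|phi0 (gam s) - q| < r.
  have nD : nbhs x (chart_dom c0).
    by apply: open_nbhs_nbhs; split; [exact: chart_dom_open|].
  have nq : nbhs x [set t | `|q - phi0 t| < r].
    have cphi : {for x, continuous phi0} by exact: linear_chart_map_continuous.
    by move/cvgrPdist_lt: cphi => /(_ r r0).
  have := gam_cont s0 Is0; rewrite /prop_for /continuous_at gam0.
  move=> /(_ _ (filterI nD nq)) /nbhs_eps[r2 r20 hr2].
  by exists r2 => // s /hr2[? ?]; rewrite distrC.
pose rr := Num.min r1 r2 / 2.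
have m0 : 0 < Num.min r1 r2 by rewrite lt_min r10.
have rr0 : 0 < rr by rewrite divr_gt0.
have hs s : `|s - s0| <= rr -> [/\ (c @` chart_dom c) (emb s), M (gam s),
    c (gam s) = emb s, chart_dom c0 (gam s) & `|phi0 (gam s) - q| < r].
  move=> ss; have : `|s - s0| < Num.min r1 r2.
    by apply: le_lt_trans ss _; rewrite /rr; lra.
  rewrite lt_min => /andP[/hr1 Is /hr2[cg gq]].
  have : (c @` (M `&` chart_dom c)) (emb s) by rewrite flat; split=> //=; rewrite row_mxKr.
  by move=> [t [Mt ct] e1]; rewrite /gam -e1 chart_mapK // in cg gq *; split=> //; exists t.
pose h s := lsubmx (phi0 (gam s)).
have [||e e0 he] := @invariance_of_domain R m h s0 rr rr0.
- move=> s /hs[Is _ _ cg _].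
  have c1 : {for s, continuous (phi0 \o gam)}.
    by apply: continuous_comp (gam_cont s Is) _; exact: linear_chart_map_continuous.
  apply/continuous_eps_delta => e e0.
  have [f f0 hf] := (continuous_eps_delta _ _).1 c1 e e0; exists f => // s' ss'.
  rewrite /h -raddfB; exact: le_lt_trans (norm_lsubmx_le _) (hf _ ss').
- move=> s s' /hs[_ Mg cg c0g gq] /hs[_ Mg' cg' c0g' gq'] hss.
  have /framed_chart_inj gg := framed_chart_eq_of_lsubmx Mg c0g Mg' c0g' gq gq' hss.
  have := cg; rewrite gg // cg' => /(congr1 lsubmx).
  by rewrite /emb !row_mxKl.
have h0 : h s0 = lsubmx q by rewrite /h gam0.
exists e => // a; rewrite -h0 => /he[s /hs[_ Mg _ c0g gq] <-].
by exists (gam s).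
Qed.

Hypothesis ball_in_chart : forall v, `|v - q| < r -> (c0 @` chart_dom c0) (v *m B).

Lemma lipschitz_local_graph :
  exists (phi : chart R P (m + n)) (UM : set 'rV[R]_m) (UN : set 'rV[R]_n)
         (f : 'rV[R]_m -> 'rV[R]_n),
  [/\ local_graph M x phi UM UN f,
      forall t, phi t = c0 t *m A,
      forall u, tangent_map x phi u = u *m A,
      K.-lipschitz_UM f &
      forall a, UM a -> S (row_mx a (f a))].
Proof.
have [e e0 he] := projection_open.
pose UM := [set a : 'rV[R]_m | `|a - lsubmx q| < e].
pose UN := [set b : 'rV[R]_n | `|b - rsubmx q| < r].
have oball k (v : 'rV[R]_k) s : open [set w : 'rV[R]_k | `|w - v| < s].
  rewrite (_ : [set _ | _] = ball v s); first exact: ball_open.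
  by apply/seteqP; split=> w; rewrite -ball_normE /= distrC.
pose W := [set v : 'rV[R]_(m + n) | UM (lsubmx v)] `&` [set v | UN (rsubmx v)].
have oW : open W.
  have cl : continuous (lsubmx : 'rV[R]_(m + n) -> 'rV[R]_m).
    exact: (@linear_row_continuous R _ _ lsubmx).
  have cr : continuous (rsubmx : 'rV[R]_(m + n) -> 'rV[R]_n).
    exact: (@linear_row_continuous R _ _ rsubmx).
  apply: openI; first by apply: (@open_comp _ _ lsubmx) => //; exact: oball.
  by apply: (@open_comp _ _ rsubmx) => //; exact: oball.
have /choice[f hf] a : exists b, UM a -> exists t,
    [/\ M t, chart_dom c0 t, `|phi0 t - q| < r & phi0 t = row_mx a b].
  have [/he[t [Mt ct tq ta]]|na] := pselect (UM a); last by exists 0.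
  by exists (rsubmx (phi0 t)) => _; exists t; rewrite -ta hsubmxK.
have near_q a b : UM a -> UN b -> `|row_mx a b - q| < r.
  move=> Ua Ub; have [t [_ _ tq ta]] := hf a Ua.
  have la : `|a - lsubmx q| < r.
    have := norm_lsubmx_le (phi0 t - q); rewrite raddfB /= ta row_mxKl -ta.
    by move/le_lt_trans; apply.
  apply: le_lt_trans (_ : _ <= Num.max `|a - lsubmx q| `|b - rsubmx q|) _.
    by apply: norm_split_le; rewrite raddfB /= ?row_mxKl ?row_mxKr le_max lexx ?orbT.
  by rewrite gt_max la.
have UNf a : UM a -> UN (f a).
  move=> /hf[t [_ _ tq ta]]; have := norm_rsubmx_le (phi0 t - q).
  by rewrite raddfB /= {1}ta row_mxKr => /le_lt_trans; apply.
pose phi := linear_chart c0 AB BA oW.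
have Wx : W (phi0 x) by split; rewrite /= /UM /UN /= subrr normr0.
exists phi, UM, UN, f; split=> //.
- split=> //; try exact: oball.
  + move=> k c' ac'; apply: linear_chart_compatible.
    exact: atlas_compatible (chart_at_atlas x) ac'.
  + rewrite [LHS](linear_chart_imgE c0 _ AB BA); apply/seteqP; split=> v.
      move=> [_ [Ul Ur]]; exists (lsubmx v) => //; exists (rsubmx v) => //.
      exact: hsubmxK.
    move=> [a Ua [b Ub <-]]; split; last by split; rewrite /= ?row_mxKl ?row_mxKr.
    exact/ball_in_chart/near_q.
  + apply/seteqP; split=> [_ [t [Mt [ct [Ul Ur]]] <-]|_ [a Ua <-]].
      have [t' [Mt' ct' tq' ta']] := hf _ Ul.
      exists (lsubmx (phi0 t)) => //; rewrite -ta'; apply/esym.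
      apply: framed_chart_eq_of_lsubmx => //; last by rewrite ta' row_mxKl.
      by rewrite -[phi0 t]hsubmxK; exact: near_q.
    have [t [Mt ct tq ta]] := hf a Ua; exists t => //; split=> //; split=> //.
    by split; rewrite /= -/(phi0 t) ta ?row_mxKl ?row_mxKr //; exact: UNf.
- by move=> u; exact: linear_chart_diff.
- move=> [a b] /= [Ua Ub]; have [t [Mt ct tq ta]] := hf a Ua.
  have [t' [Mt' ct' tq' ta']] := hf b Ub.
  have St : S (phi0 t) by exists t.
  have St' : S (phi0 t') by exists t'.
  by have := lipS St' St tq' tq; rewrite !raddfB /= ta ta' !row_mxKl !row_mxKr.
- by move=> a /hf[t [Mt ct _ ta]]; exists t.
Qed.

End graph_construction.

(** * From the cone to a graph and back *)

Section cone_to_graph.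
Context {R : realType} (P : manifold R) (M : set P) (x : P) (m n : nat).
Hypotheses (Mx : M x) (mn : (m + n)%N = dim_at x).
Variable c : chart R P (m + n).
Hypotheses (cx : chart_dom c x)
  (flat : c @` (M `&` chart_dom c) = c @` chart_dom c `&` [set v | rsubmx v = 0]).
Let C := whitney_cone x M M.
Let c0 := chart_at x.
Let c0x : chart_dom c0 x := chart_at_dom x.

Lemma strict_diff_mulmxr d e (A : 'M[R]_(d, e)) p :
  strict_diff_at (fun v => v *m A) (fun v => v *m A) p.
Proof.
move=> eps e0; exists 1 => // y z _ _.
by rewrite mulmxBl subrr normr0 mulr_ge0 // ltW.
Qed.

Lemma cone_in_frame (A : 'M[R]_(dim_at x, m + n)) (B : 'M[R]_(m + n, dim_at x)) w :
  A *m B = 1%:M ->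
  secant_cone [set c0 t *m A | t in M `&` chart_dom c0] (c0 x *m A) w -> C (w *m B).
Proof.
move=> AB hw; rewrite /C whitney_coneE.
have -> : chart_at x x = c0 x *m A *m B by rewrite -mulmxA AB mulmx1.
apply: (@secant_cone_image _ _ _ _ _ (mulmxr B) (mulmxr B) _ 1 w ltr01 _ _ hw).
  by move=> _ [t Mt <-] _; exists t => //=; rewrite -mulmxA AB mulmx1.
exact: strict_diff_mulmxr.
Qed.

(** In a frame where [F] is horizontal and [G] vertical, the graph of slope at most
    [K] exists by [lipschitz_local_graph], after shrinking the radius so that the
    ball around the image of x lies in the image of the chart.  If the cone lies
    in [F], the slopes of the secants tend to 0, hence the derivative is 0. *)
Lemma local_graph_of_cone (F G : {vspace 'rV[R]_(dim_at x)}) :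
  \dim F = m -> \dim G = n -> (F + G)%VS = fullv ->
  C `&` [set u | u \in G] = [set 0] ->
  exists (phi : chart R P (m + n)) (UM : set 'rV[R]_m) (UN : set 'rV[R]_n)
         (f : 'rV[R]_m -> 'rV[R]_n),
  [/\ local_graph M x phi UM UN f,
      forall a, UM a -> lipschitz_at f a,
      tangent_map x phi @` [set u | u \in G] = [set v | lsubmx v = 0] &
      (forall u, C u -> u \in F) -> strictly_differentiable f (lsubmx (phi x))].
Proof.
move=> dF dG FG CG; have [A [B [AB BA hG hF]]] := adapted_frame mn dF dG FG.
set S := [set c0 t *m A | t in M `&` chart_dom c0]; set q := c0 x *m A.
have tr w : secant_cone S q w -> lsubmx w = 0 -> w = 0.
  move=> hw lw; have Cw := cone_in_frame AB hw.
  have wG : w *m B \in G by apply/hG; rewrite -mulmxA BA mulmx1.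
  have : (C `&` [set u | u \in G]) (w *m B) by [].
  by rewrite CG => /(congr1 (mulmx^~ A)); rewrite -mulmxA BA mulmx1 mul0mx.
have [K K0 [r r0 hK]] := secant_cone_lipschitz tr.
have [r1 r10 hr1] : exists2 r1, 0 < r1 &
    forall v, `|v - q| < r1 -> (c0 @` chart_dom c0) (v *m B).
  have oI : open [set v : 'rV[R]_(m + n) | (c0 @` chart_dom c0) (v *m B)].
    apply: (@open_comp _ _ (fun v : 'rV[R]_(m + n) => v *m B)); last exact: chart_img_open.
    by move=> v _; exact: mulmxr_continuous.
  apply/nbhs_eps; apply: open_nbhs_nbhs; split=> //=.
  by exists x => //; rewrite /q -mulmxA AB mulmx1.
have rho0 : 0 < Num.min r r1 by rewrite lt_min r0.
have hK' y z : S y -> S z -> `|y - q| < Num.min r r1 -> `|z - q| < Num.min r r1 ->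
    `|rsubmx (z - y)| <= K * `|lsubmx (z - y)|.
  by rewrite !lt_min => Sy Sz /andP[yr _] /andP[zr _]; exact: hK.
have hr1' v : `|v - q| < Num.min r r1 -> (c0 @` chart_dom c0) (v *m B).
  by rewrite lt_min => /andP[_]; exact: hr1.
have [phi [UM [UN [f [lg phiE Tphi lipf graphS]]]]] :=
  lipschitz_local_graph AB BA rho0 Mx hK' cx flat hr1'.
have [_ phix oM _ _ _ grE] := lg.
have [a0 Ua0 a0E] : [set row_mx a (f a) | a in UM] (phi x) by rewrite -grE; exists x.
exists phi, UM, UN, f; split=> //.
- by move=> a Ua; exists K; exists UM => //; exact: open_nbhs_nbhs.
- apply/seteqP; split=> [_ [u uG <-]|v lv] /=; first by rewrite Tphi; exact/hG.
  exists (v *m B); last by rewrite Tphi -mulmxA BA mulmx1.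
  by apply/hG; rewrite -mulmxA BA mulmx1.
move=> CF; rewrite -a0E row_mxKl.
have fl w : secant_cone S q w -> rsubmx w = 0.
  by move=> /(cone_in_frame AB)/CF/hF; rewrite -mulmxA BA mulmx1.
have qE : q = row_mx a0 (f a0) by rewrite a0E phiE.
exists \0 => e e0; have [s s0 hs] := secant_cone_flat fl e0.
have [t t0 ht] := (nbhs_eps _ _).1 (open_nbhs_nbhs (conj oM Ua0)).
pose t' := Num.min t (Num.min s (s / K)).
have t'0 : 0 < t' by rewrite !lt_min t0 s0 divr_gt0.
exists [set a | `|a - a0| < t']; first by apply/nbhs_eps; exists t'.
have near a : `|a - a0| < t' -> UM a /\ `|row_mx a (f a) - q| < s.
  rewrite !lt_min => /and3P[/ht Ua as1 asK]; split=> //.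
  have fa : `|f a - f a0| < s.
    apply: le_lt_trans (lipf (a, a0) (conj Ua Ua0)) _.
    by rewrite /= mulrC -ltr_pdivlMr.
  apply: le_lt_trans (_ : _ <= Num.max `|a - a0| `|f a - f a0|) _.
    rewrite qE opp_row_mx add_row_mx.
    by apply: norm_split_le; rewrite ?row_mxKl ?row_mxKr le_max lexx ?orbT.
  by rewrite gt_max as1.
move=> [a b] /= [/near[Ua aq] /near[Ub bq]].
have := hs _ _ (graphS b Ub) (graphS a Ua) bq aq.
by rewrite opp_row_mx add_row_mx row_mxKl row_mxKr !subr0.
Qed.

End cone_to_graph.

Lemma strictly_differentiable_diff (R : realType) m n (f : 'rV[R]_m -> 'rV[R]_n) y :
  strictly_differentiable f y -> strict_diff_at f ('d f y) y.
Proof.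
move=> [L hL]; have sL : strict_diff_at f L y.
  move=> e e0; have [V nV lV] := hL e e0; have [r r0 hr] := (nbhs_eps _ _).1 nV.
  exists r => // a b ar br; have := lV (b, a) (conj (hr _ br) (hr _ ar)).
  rewrite /= (_ : f b - f a - L (b - a) = f b - L b - (f a - L a)) //.
  by rewrite linearB !opprB addrACA [RHS]addrACA [- f a - _]addrC.
have [_ e1] : differentiable f y /\ 'd f y = L :> (_ -> _).
  apply: diff_eps_unique; first exact: linear_row_continuous.
  move=> e e0; have [r r0 hr] := sL e e0; exists r => // z zr.
  by apply: hr => //; rewrite subrr normr0.
by rewrite e1.
Qed.

Lemma whitney_cone0 (R : realType) (P : manifold R) (M : set P) (x : P) :
  M x -> whitney_cone x M M 0.
Proof.
move=> Mx; exists (fun=> x), (fun=> x), (fun=> 1); split.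
- by [].
- exact: cvg_cst.
- exact: cvg_cst.
- by under eq_fun do rewrite subrr scaler0; exact: cvg_cst.
Qed.

Section graph_to_cone.
Context {R : realType} (P : manifold R) (M : set P) (x : P) (m n : nat).
Hypothesis Mx : M x.
Variables (phi : chart R P (m + n)) (UM : set 'rV[R]_m) (UN : set 'rV[R]_n).
Variable f : 'rV[R]_m -> 'rV[R]_n.
Hypothesis lg : local_graph M x phi UM UN f.
Let C := whitney_cone x M M.
Let a0 := lsubmx (phi x).

Lemma local_graph_center : UM a0 /\ phi x = row_mx a0 (f a0).
Proof.
have [_ phix _ _ _ _ grE] := lg.
have [a Ua aE] : [set row_mx a (f a) | a in UM] (phi x) by rewrite -grE; exists x.
by rewrite /a0 -aE row_mxKl.
Qed.

Lemma tangent_cone_graph : tangent_map x phi @` C =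
  secant_cone [set row_mx a (f a) | a in UM] (row_mx a0 (f a0)).
Proof.
have [sphi phix _ _ _ _ grE] := lg.
by rewrite /C tangent_map_cone // grE -local_graph_center.2.
Qed.

Lemma lipschitz_graph_transverse (G : {vspace 'rV[R]_(dim_at x)}) :
  lipschitz_at f a0 ->
  tangent_map x phi @` [set u : 'rV[R]_(dim_at x) | u \in G] = [set v | lsubmx v = 0] ->
  C `&` [set u | u \in G] = [set 0].
Proof.
move=> lipf TG; have [sphi phix _ _ _ _ _] := lg.
have Tinj u u' : tangent_map x phi u = tangent_map x phi u' -> u = u'.
  by move=> e; rewrite -(tangent_mapK sphi phix u) e tangent_mapK.
apply/seteqP; split=> [u [Cu uG]|_ ->] /=.
  apply: Tinj; rewrite [RHS]linear0.
  apply: (lipschitz_graph_cone (U := UM) lipf).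
    by rewrite -tangent_cone_graph; exists u.
  have : [set v | lsubmx v = 0] (tangent_map x phi u) by rewrite -TG; exists u.
  by [].
by split; [exact: whitney_cone0|exact: mem0v].
Qed.

Lemma strict_graph_tangent_cone : strictly_differentiable f a0 ->
  tangent_map x phi @` C =
    [set row_mx u ('d f a0 u) | u in [set: 'rV[R]_m]].
Proof.
move=> /strictly_differentiable_diff sf; rewrite tangent_cone_graph.
have [_ _ oM _ _ _ _] := lg; have [Ua0 _] := local_graph_center.
apply/seteqP; split=> [w hw|_ [u _ <-]]; last exact: graph_cone_strict.
by exists (lsubmx w) => //; rewrite -(strict_graph_cone sf hw) hsubmxK.
Qed.

(** The subspace is the tangent space of M, the preimage of the graph of
    ['d f a0] under the tangent map. *)
Lemma strict_graph_subspace : strictly_differentiable f a0 ->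
  exists2 F : {vspace 'rV[R]_(dim_at x)}, \dim F = m & C `<=` [set u | u \in F].
Proof.
move=> sf; have [sphi phix _ _ _ _ _] := lg.
pose g (u : 'rV[R]_m) : 'rV[R]_(dim_at x) :=
  'd (transition phi (chart_at x)) (phi x) (row_mx u ('d f a0 u)).
have g_lin : linear g.
  by move=> k u v; rewrite /g linearP -add_row_mx -scale_row_mx linearP.
pose gL := GRing.isLinear.Build _ _ _ _ g g_lin.
pose gl : {linear 'rV[R]_m -> 'rV[R]_(dim_at x)} := HB.pack g gL.
exists (limg (linfun gl)).
  have k0 : lker (linfun gl) == 0%VS.
    apply/lker0P => u v; rewrite !lfunE /= /g => /(congr1 (tangent_map x phi)).
    by rewrite !tangent_mapKV // => /(congr1 lsubmx); rewrite !row_mxKl.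
  by rewrite limg_dim_eq ?(eqP k0) ?capv0 // dimvf /dim /= mul1n.
move=> u Cu; have : [set row_mx u ('d f a0 u) | u in [set: 'rV[R]_m]] (tangent_map x phi u).
  by rewrite -strict_graph_tangent_cone //; exists u.
move=> [v _ e]; rewrite /= -(tangent_mapK sphi phix u) -e.
have -> : 'd (transition phi (chart_at x)) (phi x) (row_mx v ('d f a0 v)) = linfun gl v.
  by rewrite lfunE.
exact: memv_img (memvf _).
Qed.

End graph_to_cone.

Theorem proposition3p4 (R : realType) (P : manifold R) (M : set P)
    (hM : C0_submanifold M) (x : P) (hx : M x) :
  let m := submanifold_dim M x in
  let n := submanifold_codim M x in
  let C := whitney_cone x M M in
  (forall F : {vspace 'rV[R]_(dim_at x)}, \dim F = n ->
    (exists (phi : chart R P (m + n)) (UM : set 'rV[R]_m) (UN : set 'rV[R]_n)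
            (f : 'rV[R]_m -> 'rV[R]_n),
       [/\ local_graph M x phi UM UN f,
           forall a, UM a -> lipschitz_at f a &
           tangent_map x phi @` [set u : 'rV[R]_(dim_at x) | u \in F] =
             [set v | lsubmx v = 0]])
    <-> C `&` [set u | u \in F] = [set 0])
  /\
  ((exists (phi : chart R P (m + n)) (UM : set 'rV[R]_m) (UN : set 'rV[R]_n)
           (f : 'rV[R]_m -> 'rV[R]_n),
      local_graph M x phi UM UN f /\
      strictly_differentiable f (lsubmx (phi x)))
   <-> exists2 F : {vspace 'rV[R]_(dim_at x)},
         \dim F = m & C `<=` [set u | u \in F])
  /\
  (forall (phi : chart R P (m + n)) (UM : set 'rV[R]_m) (UN : set 'rV[R]_n)
          (f : 'rV[R]_m -> 'rV[R]_n),
     local_graph M x phi UM UN f ->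
     strictly_differentiable f (lsubmx (phi x)) ->
     tangent_map x phi @` C =
       [set row_mx u ('d f (lsubmx (phi x)) u) | u in [set: 'rV[R]_m]]).
Proof.
move=> m n C.
have [n' [mn' [c [cx flat]]]] : locally_flat_at M x m.
  have [k hk] := hM x hx; rewrite /m /submanifold_dim.
  by apply: (@xgetPex _ 0%N [set m | locally_flat_at M x m]); exists k.
have nE : n' = n by rewrite /n /submanifold_codim -/m -mn' addKn.
subst n'.
have dimC (F : {vspace 'rV[R]_(dim_at x)}) k l : (k + l)%N = dim_at x ->
    \dim F = k -> \dim (F^C)%VS = l.
  by move=> kl dF; rewrite dimv_compl dimvf /dim /= mul1n dF -kl addKn.
split; [|split].
- move=> F dF; split=> [[phi [UM [UN [f [lg lipf TF]]]]]|CF].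
    apply: (lipschitz_graph_transverse hx lg _ TF); apply: lipf.
    exact: (local_graph_center hx lg).1.
  have dFC : \dim (F^C)%VS = m by apply: dimC dF; rewrite addnC.
  have FF : (F^C + F)%VS = fullv by rewrite addvC addv_complf.
  have [phi [UM [UN [f [lg lipf TF _]]]]] :=
    local_graph_of_cone hx mn' cx flat dFC dF FF CF.
  by exists phi, UM, UN, f.
- split=> [[phi [UM [UN [f [lg sf]]]]]|[F dF CF]].
    exact: (strict_graph_subspace hx lg sf).
  (* a complement of [F] meets the cone trivially and serves as vertical factor *)
  have dFC : \dim (F^C)%VS = n by exact: dimC dF.
  have FC : C `&` [set u | u \in (F^C)%VS] = [set 0].
    apply/seteqP; split=> [u [/CF uF uFC]|_ ->] /=.
      have : u \in (F :&: F^C)%VS by rewrite memv_cap; apply/andP.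
      by rewrite capv_compl memv0 => /eqP.
    by split; [exact: whitney_cone0|exact: mem0v].
  have [phi [UM [UN [f [lg _ _ sf]]]]] :=
    local_graph_of_cone hx mn' cx flat dF dFC (addv_complf F) FC.
  by exists phi, UM, UN, f; split=> //; exact: sf.
- by move=> phi UM UN f lg sf; exact: (strict_graph_tangent_cone hx lg sf).
Qed.
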